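(* Let $[r]$ be any non-trivial rail arc class that admits a planar knotoid projection $\kappa$ whose head and tail can be connected by a simple arc in the complement of the interior of $\kappa$. Then the stick number of $[r]$ satisfies $$4+2\bigl(|w[r]|-1\bigr)\le s[r],$$ where $w[r]\in\mathbb{Z}$ is the winding number of $[r]$.
   Context: Rail arcs. Let $\ell_1,\ell_2\subset\mathbb{R}^3$ be two parallel lines, called rails. A rail arc is an embedding of a simple arc $r$ in $\mathbb{R}^3$ with one endpoint on $\ell_1$, the other on $\ell_2$, and interior disjoint from $\ell_1\cup\ell_2$. Two rail arcs are rail isotopic if there is an ambient isotopy of $\mathbb{R}^3$ taking one to the other while mapping each rail onto itself throughout. A rail arc class $[r]$ is a rail isotopy class; it is trivial if $r$ is rail isotopic into a plane. A stick rail arc is a piecewise linear rail arc seen as a finite union of line segments (sticks); the stick number $s[r]$ is the minimum number of sticks of a stick rail arc representing $[r]$. Planar knotoid projection. Generically projecting a rail arc onto a plane perpendicular to the rails gives a planar knotoid diagram: a generic immersion of $[0,1]$ in $\mathbb{R}^2$ with over/under information at each double point and distinct endpoints, called tail $T$ (image of $0$) and head $H$ (image of $1$). Winding number. Let $\kappa$ be a planar knotoid diagram of a representative of $[r]$ whose head and tail belong to the same region of the plane, and let $\alpha$ be a simple arc from $H$ to $T$ meeting $\kappa$ only at its endpoints, chosen so that the closed curve $\gamma=\kappa\cup\alpha$ (oriented from $T$ to $H$ along $\kappa$, then back along $\alpha$) is smooth where $\kappa$ and $\alpha$ meet. For a point $p\in\{H,T\}$ of $\gamma$, parametrize $\gamma$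 starting and ending at $p$ by polar coordinates $(r_p(t),\theta_p(t))$ based at $p$, $0<t<1$, with $\theta_p$ continuous, and set $$w_\gamma(p)=\frac{\lim_{t\to1^-}\theta_p(t)-\lim_{t\to0^+}\theta_p(t)}{2\pi}\in\tfrac12\mathbb{Z}.$$ One has $w_\gamma(H)=w_\gamma(T)$. The winding number of $[r]$ is $$w[r]:=\operatorname{sgn}(w_\gamma(H))\,\lfloor|w_\gamma(H)|\rfloor ,$$ where $\lfloor\cdot\rfloor$ is the floor function and $\operatorname{sgn}(x)$ is $-1,0,1$ according to whether $x<0$, $x=0$, $x>0$. This is independent of the choice of such $\kappa$ and $\alpha$, hence an invariant of those rail arc classes that admit such a projection. *)

(* Defs.v *)
From HB Require Import structures.
From mathcomp Require Import all_boot all_order all_algebra.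
From mathcomp Require Import all_classical all_reals all_analysis.

Set Implicit Arguments.
Unset Strict Implicit.
Unset Printing Implicit Defensive.

Import Order.TTheory GRing.Theory Num.Theory.
Import numFieldNormedType.Exports.

Local Open Scope ring_scope.
Local Open Scope classical_set_scope.

(* An arc is given by a function on R, of which only the restriction to [0, 1]
   is ever used. *)

Section Arcs.
Context {R : realType}.

Definition simple_arc n (r : R -> 'rV[R]_n.+1) : Prop :=
  {within `[0, 1], continuous r} /\ {in `[0, 1]%R &, injective r}.

Definition arc_image n (r : R -> 'rV[R]_n.+1) : set 'rV[R]_n.+1 :=
  r @` `[0, 1].

End Arcs.

Section RailArcs.
Context {R : realType}.
Implicit Types (d : 'rV[R]_3) (r : R -> 'rV[R]_3).

Definition line (a d : 'rV[R]_3) : set 'rV[R]_3 :=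
  range (fun t : R => a + t *: d).

Definition parallel_rails d (l1 l2 : set 'rV[R]_3) : Prop :=
  [/\ d != 0, exists a, l1 = line a d, exists a, l2 = line a d & l1 <> l2].

(* Arcs are oriented from l1 to l2. *)
Definition rail_arc (l1 l2 : set 'rV[R]_3) r : Prop :=
  [/\ simple_arc r, l1 (r 0), l2 (r 1) &
      forall t : R, 0 < t < 1 -> ~ (l1 `|` l2) (r t)].

Definition homeomorphism (f : 'rV[R]_3 -> 'rV[R]_3) : Prop :=
  continuous f /\
  exists g, [/\ continuous g, cancel f g & cancel g f].

Definition ambient_isotopy (F : R -> 'rV[R]_3 -> 'rV[R]_3) : Prop :=
  [/\ {within `[0, 1] `*` setT,
         continuous (fun z : R * 'rV[R]_3 => F z.1 z.2)},
      F 0 = id &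
      forall t : R, 0 <= t <= 1 -> homeomorphism (F t)].

Definition rail_isotopic (l1 l2 : set 'rV[R]_3) r r' : Prop :=
  exists F, [/\ ambient_isotopy F,
    forall t : R, 0 <= t <= 1 -> F t @` l1 = l1 /\ F t @` l2 = l2 &
    F 1 @` arc_image r = arc_image r'].

Definition represents (l1 l2 : set 'rV[R]_3) r r' : Prop :=
  rail_arc l1 l2 r' /\ rail_isotopic l1 l2 r r'.

Definition plane (n : 'cV[R]_3) (c : 'M[R]_1) : set 'rV[R]_3 :=
  [set x | x *m n = c].

Definition trivial_class (l1 l2 : set 'rV[R]_3) r : Prop :=
  exists r', represents l1 l2 r r' /\
    exists n c, n != 0 /\ arc_image r' `<=` plane n c.

Definition affine_between r (a b : R) : Prop :=
  forall s : R, 0 <= s <= 1 ->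
    r ((1 - s) * a + s * b) = (1 - s) *: r a + s *: r b.

Definition made_of_sticks (n : nat) r : Prop :=
  exists t : nat -> R, [/\ t 0%N = 0, t n = 1 &
    forall i, (i < n)%N -> t i < t i.+1 /\ affine_between r (t i) (t i.+1)].

(* The infimum of a set of natural numbers is its minimum when the set is
   nonempty, and +oo for a (wild) class without stick representative. *)
Definition stick_number (l1 l2 : set 'rV[R]_3) r : \bar R :=
  ereal_inf [set (n%:R)%:E | n in
    [set n : nat | exists r', represents l1 l2 r r' /\ made_of_sticks n r']].

End RailArcs.

Section Knotoids.
Context {R : realType}.
Implicit Types (k a g : R -> 'rV[R]_2) (r : R -> 'rV[R]_3).

(* x |-> x *m P is the orthogonal projection onto the plane d^perp, written in
   the orthonormal basis of this plane formed by the columns of P. *)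
Definition perp_projection (d : 'rV[R]_3) (P : 'M[R]_(3, 2)) : Prop :=
  P^T *m P = 1%:M /\ d *m P = 0.

Definition project (P : 'M[R]_(3, 2)) r : R -> 'rV[R]_2 := fun t => r t *m P.

(* C^oo on a neighbourhood of t. *)
Definition smooth_at g (t : R) : Prop :=
  \forall s \near t, forall n : nat, derivable (g^`(n)) s 1.

Definition regular_at g (t : R) : Prop := smooth_at g t /\ g^`() t != 0.

(* The over/under information at a double point is carried by the arc r that
   is projected, so that only the underlying plane curve is constrained. *)
Definition generic_immersion k : Prop :=
  exists f, [/\ {in `[0, 1]%R, k =1 f},
    forall t : R, 0 <= t <= 1 -> regular_at f t,
    forall s t : R, 0 <= s <= 1 -> 0 <= t <= 1 -> s != t -> k s = k t ->
      row_free (col_mx (f^`()%classic s) (f^`()%classic t)),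
    forall s t u : R, 0 <= s <= 1 -> 0 <= t <= 1 -> 0 <= u <= 1 ->
      k s = k t -> k t = k u -> [|| s == t, t == u | s == u] &
    finite_set [set z : R * R |
      [/\ 0 <= z.1 <= 1, 0 <= z.2 <= 1, z.1 < z.2 & k z.1 = k z.2]]].

(* The tail is k 0 and the head is k 1. *)
Definition knotoid_diagram k : Prop :=
  [/\ generic_immersion k, k 0 != k 1 &
      forall t : R, 0 < t < 1 -> k t != k 0 /\ k t != k 1].

Definition connecting_arc k a : Prop :=
  [/\ simple_arc a, a 0 = k 1, a 1 = k 0 &
      forall s t : R, 0 <= s <= 1 -> 0 < t < 1 -> a s != k t].

Definition admits_connectable_projection (l1 l2 : set 'rV[R]_3)
    (P : 'M[R]_(3, 2)) r : Prop :=
  exists r', [/\ represents l1 l2 r r', knotoid_diagram (project P r') &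
    exists a, connecting_arc (project P r') a].

(* g is a 1-periodic parametrization of the closed curve that runs along k from
   the tail g 0 to the head g (1/2), and back along a; it is smooth and regular
   at these two points. *)
Definition closed_curve k a g : Prop :=
  [/\ forall t : R, g (t + 1) = g t,
      forall t : R, 0 <= t <= 1 -> g (t / 2) = k t,
      forall t : R, 0 <= t <= 1 -> g ((1 + t) / 2) = a t,
      regular_at g 0 & regular_at g (1 / 2)].

Definition polar (rho theta : R) : 'rV[R]_2 :=
  rho *: \row_(i < 2) (if i == 0 then cos theta else sin theta).

(* w is the winding number of the 1-periodic curve g at its point g s. *)
Definition curve_winding g (s w : R) : Prop :=
  exists rho theta : R -> R, exists th0 th1 : R,
  [/\ forall t : R, 0 < t < 1 ->
        0 < rho t /\ g (s + t) - g s = polar (rho t) (theta t),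
      {within `]0, 1[, continuous theta},
      theta x @[x --> 0^'+] --> th0,
      theta x @[x --> 1^'-] --> th1 &
      w = (th1 - th0) / (2 * pi)].

(* m is the winding number of the class of r, computed at the head g (1/2) from
   some projection and some connecting arc; it does not depend on these choices,
   and its sign depends on the orientation of the basis P. *)
Definition winding_number (l1 l2 : set 'rV[R]_3) (P : 'M[R]_(3, 2)) r
    (m : int) : Prop :=
  exists r', exists a g, exists w : R,
  [/\ represents l1 l2 r r' /\ knotoid_diagram (project P r'),
      connecting_arc (project P r') a,
      closed_curve (project P r') a g,
      curve_winding g (1 / 2) w &
      m = sgz w * Num.floor `|w|].

End Knotoids.

(* Main.v *)
Require Import Defs.
From mathcomp Require Import all_boot all_order all_algebra.
From mathcomp Require Import all_classical all_reals all_analysis.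
From mathcomp Require Import lra ring.
Import Order.TTheory GRing.Theory Num.Theory.
Import numFieldNormedType.Exports.
Local Open Scope ring_scope.

(** Project along the rails to the plane, where the rails become two points [T]
    and [H], and apply the similarity that moves [T] to [-1] and [H] to [1]. A
    rail arc gives a path [p] from [-1] to [1] whose interior avoids both points,
    and a rail isotopy gives a homotopy of such paths. The Joukowski map
    [z |-> (z + 1/z) / 2] is a double covering of the plane by the punctured
    plane, branched over [-1] and [1]. Lift [p] to [z]: the total variation of
    the argument of [z], up to sign, is the turning of the arc. A lift of [p]
    ends at the branch points [z = -1] and [z = 1], so that the turning is an odd
    multiple of [pi], and it does not change during a homotopy: it is an invariant
    of rail isotopy ([joukowski_lift], [turning_homotopy], [turning_uniq],
    [turning_represents]).

    The argument of [z] is a multiple of [pi] only where [p] is on the real axis,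
    outside the open segment from [-1] to [1]. On a stick of an arc made of
    [n > 1] sticks, it takes at most one of these multiples ([stick_crossing]).
    So it has varied by less than [i * pi] after [i] sticks, and the turning is
    less than [n * pi] ([turning_lt_sticks]).

    For an arc whose projection is completed to a closed curve by a simple arc
    from [H] to [T], slide the branch point [T] along this simple arc towards
    [H]; the arc grows by the part of the simple arc that is left
    behind. Simplicity of the connecting arc and its disjointness from the
    projection make this a homotopy as above, hence the turning is unchanged.
    Once the two branch points are close to each other, the rest of the curve
    avoids the segment between them ([start_point]), so that [z] stays off the
    unit circle and its argument remains within [pi] of the angle of the curve
    seen from [H] ([angle_bound]). Both total variations are odd multiples of
    [pi], because the closed curve is regular at [H], and so they are equal: the
    turning is [2 * pi * |w|], where the half-integer [w] is the winding number
    of the closed curve at [H] ([turning_winding], [turning_knotoid]).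

    Therefore [2 * |w| < n], and since [2 * |w|] is odd, [n] is at least
    [2 * floor |w| + 2]. A single stick lies in a plane and is excluded by
    nontriviality. *)

Set Implicit Arguments.
Unset Strict Implicit.
Unset Printing Implicit Defensive.

Local Open Scope classical_set_scope.

(** * Continuity of real functions *)

Section Continuity.
Context {R : realType} {T : topologicalType}.
Implicit Types f g : T -> R.

Lemma contD f g : continuous f -> continuous g ->
  continuous (fun x => f x + g x).
Proof. by move=> cf cg x; apply: cvgD; [exact: cf|exact: cg]. Qed.

Lemma contN f : continuous f -> continuous (fun x => - f x).
Proof. by move=> cf x; apply: cvgN; exact: cf. Qed.

Lemma contM f g : continuous f -> continuous g ->
  continuous (fun x => f x * g x).
Proof. by move=> cf cg x; apply: cvgM; [exact: cf|exact: cg]. Qed.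

Lemma contX f n : continuous f -> continuous (fun x => f x ^+ n).
Proof.
move=> cf; elim: n => [|n IH]; first by move=> x; exact: cvg_cst.
by under eq_fun do rewrite exprS; exact: contM.
Qed.

Lemma contV f : (forall x, f x != 0) -> continuous f ->
  continuous (fun x => (f x)^-1).
Proof. by move=> f0 cf x; apply: cvgV; [exact: f0|exact: cf]. Qed.

Lemma cont_cst (a : R) : continuous (fun _ : T => a).
Proof. by move=> x; exact: cvg_cst. Qed.

Lemma cont_norm f : continuous f -> continuous (fun x => `|f x|).
Proof. by move=> cf x; apply: cvg_norm; exact: cf. Qed.

Lemma cont_max f g : continuous f -> continuous g ->
  continuous (fun x => Num.max (f x) (g x)).
Proof. by move=> cf cg x; exact: (@continuous_max R T f g x (cf x) (cg x)). Qed.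

Lemma cont_min f g : continuous f -> continuous g ->
  continuous (fun x => Num.min (f x) (g x)).
Proof. by move=> cf cg x; exact: (@continuous_min R T f g x (cf x) (cg x)). Qed.

End Continuity.

Lemma cont_comp (S T U : topologicalType) (g : T -> U) (f : S -> T) :
  continuous g -> continuous f -> continuous (fun x => g (f x)).
Proof. by move=> cg cf x; exact: (continuous_comp (cf x) (cg (f x))). Qed.

Lemma cont_pair (S T U : topologicalType) (f : S -> T) (g : S -> U) :
  continuous f -> continuous g -> continuous (fun x => (f x, g x)).
Proof. by move=> cf cg x; apply: cvg_pair; [exact: cf|exact: cg]. Qed.

Lemma cont_id (T : topologicalType) : continuous (fun x : T => x).
Proof. by move=> x. Qed.

Lemma cont_fst (T U : topologicalType) : continuous (fun x : T * U => x.1).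
Proof. by move=> x; exact: cvg_fst. Qed.

Lemma cont_snd (T U : topologicalType) : continuous (fun x : T * U => x.2).
Proof. by move=> x; exact: cvg_snd. Qed.

Lemma cont_pairl (T U : topologicalType) (a : T) :
  continuous (fun x : U => (a, x)).
Proof. by move=> x; apply: cvg_pair; [exact: cvg_cst|exact: cvg_id]. Qed.

Section ScalarContinuity.
Context {R : realType}.
Implicit Type a : R.

Lemma cont_mull a : continuous (fun x : R => a * x).
Proof. exact: (@contM R R _ _ (@cont_cst R R a) (@cont_id R)). Qed.

Lemma cont_addl a : continuous (fun x : R => a + x).
Proof. exact: (@contD R R _ _ (@cont_cst R R a) (@cont_id R)). Qed.

Lemma cont_opp : continuous (fun x : R => - x).
Proof. exact: (@contN R R _ (@cont_id R)). Qed.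

End ScalarContinuity.

(* Unification eta-contracts some subgoals, hence the clauses for operations
   that lack their last argument. *)
Ltac cont_step :=
  match goal with
  | |- continuous ?f => match f with
    | fun _ => ?a => exact: cont_cst
    | fst => exact: cont_fst
    | @pair _ _ _ => exact: cont_pairl
    | snd => exact: cont_snd
    | fun x => fst x => exact: cont_fst
    | fun x => snd x => exact: cont_snd
    | @GRing.mul _ _ => exact: cont_mull
    | @Algebra.add _ _ => exact: cont_addl
    | @Algebra.opp _ => exact: cont_opp
    | @Num.norm _ _ => exact: norm_continuous
    | fun x => @Algebra.opp _ _ => apply: contN
    | fun x => @Algebra.add _ _ _ => apply: contD
    | fun x => @GRing.exp _ _ _ => apply: contX
    | fun x => @GRing.mul _ _ _ => apply: contM
    | fun x => @Num.norm _ _ _ => apply: cont_norm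
    | fun x => Num.max _ _ => apply: cont_max
    | fun x => Num.min _ _ => apply: cont_min
    | fun x => (_, _) => apply: cont_pair
    | fun x => fst (@?g x) => apply: (cont_comp (@cont_fst _ _) (f := g))
    | fun x => snd (@?g x) => apply: (cont_comp (@cont_snd _ _) (f := g))
    | _ => first [ assumption | exact: cont_id ]
    end
  end.
Ltac cont := repeat cont_step.

Section Clamp.
Context {R : realType}.

Definition clamp (a b x : R) : R := Num.max a (Num.min x b).

Lemma clamp_cont a b : continuous (clamp a b).
Proof. by rewrite /clamp; cont. Qed.

Lemma clamp_in a b x : a <= b -> a <= clamp a b x <= b.
Proof. by move=> ab; rewrite /clamp le_max lexx ge_max ge_min lexx orbT ab. Qed.

Lemma clamp_id a b x : a <= x <= b -> clamp a b x = x.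
Proof.
by case/andP=> ax xb; rewrite /clamp; rewrite (min_idPl xb); apply/max_idPr.
Qed.

Lemma clamp_lt a b x : x <= a -> a <= b -> clamp a b x = a.
Proof.
move=> xa ab; rewrite /clamp (min_idPl _) ?(le_trans xa ab)//.
exact/max_idPl.
Qed.

Lemma clamp_gt a b x : b <= x -> a <= b -> clamp a b x = b.
Proof. by move=> bx ab; rewrite /clamp (min_idPr bx); apply/max_idPr. Qed.

End Clamp.

(** * Lifting angles *)

Section Angles.
Context {R : realType}.
Implicit Types (x y a b t : R).

(** The zeros of the sine are isolated, so the intermediate value theorem
    applies. Two lifts of the same angle are compared in this way: the sine of
    their difference vanishes. *)
Lemma sin0_constant (f : R -> R) a b : continuous f -> a <= b ->
  (forall t, a <= t <= b -> sin (f t) = 0) -> f a = f b.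
Proof.
move=> cf ab f0; apply/eqP; apply: contraT => fab.
have pi0 := pi_gt0 R.
pose e := Num.min (pi / 2) (`|f b - f a| / 2).
have e0 : 0 < e by rewrite /e lt_min !divr_gt0 ?normr_gt0 ?subr_eq0 1?eq_sym//.
have epi : e < pi by rewrite gt_min; apply/orP; left; lra.
have eab : e <= `|f b - f a| / 2 by rewrite /e ge_min lexx orbT.
have sine : sin e != 0 by rewrite gt_eqF// sin_gt0_pi// e0.
pose v := if f a < f b then f a + e else f a - e.
have [c cab fcv] : exists2 c, c \in `[a, b]%R & f c = v.
  apply: IVT => //; first exact: continuous_subspaceT.
  rewrite /v ge_min le_max; move: eab.
  case: ltP => h; first by rewrite gtr0_norm ?subr_gt0// => ?; apply/andP; split; apply/orP; lra.
  by rewrite ler0_norm ?subr_le0// => ?; apply/andP; split; apply/orP; lra.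
move: cab; rewrite in_itv/= => /f0; rewrite fcv /v.
have fa0 : sin (f a) = 0 by apply: f0; rewrite lexx.
have /eqP := cos2Dsin2 (f a); rewrite fa0 expr0n addr0 => ca.
have ca0 : cos (f a) != 0.
  by apply: contraTneq ca => ->; rewrite expr0n eq_sym oner_eq0.
case: ifP => _; rewrite ?sinB ?sinD fa0 mul0r ?add0r ?sub0r => /eqP.
  by rewrite mulf_eq0 (negbTE ca0) (negbTE sine).
by rewrite oppr_eq0 mulf_eq0 (negbTE ca0) (negbTE sine).
Qed.

(** When the inner product of [a] and [b] is positive, the quotient [b / a] of
    complex numbers has positive real part, and its argument is an arctangent
    that depends continuously on [a] and [b]. *)
Lemma rotate_atan a1 a2 b1 b2 th : 0 < a1 * b1 + a2 * b2 ->
  a1 = Num.sqrt (a1 ^+ 2 + a2 ^+ 2) * cos th ->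
  a2 = Num.sqrt (a1 ^+ 2 + a2 ^+ 2) * sin th ->
  let th' := th + atan ((a1 * b2 - a2 * b1) / (a1 * b1 + a2 * b2)) in
  b1 = Num.sqrt (b1 ^+ 2 + b2 ^+ 2) * cos th' /\
  b2 = Num.sqrt (b1 ^+ 2 + b2 ^+ 2) * sin th'.
Proof.
move=> d0 ha1 ha2 /=; set d := a1 * b1 + a2 * b2 in d0 *.
set c := a1 * b2 - a2 * b1.
set ra := Num.sqrt _ in ha1 ha2; set rb := Num.sqrt _.
have ra2 : ra ^+ 2 = a1 ^+ 2 + a2 ^+ 2 by rewrite sqr_sqrtr// addr_ge0// sqr_ge0.
have rb2 : rb ^+ 2 = b1 ^+ 2 + b2 ^+ 2 by rewrite sqr_sqrtr// addr_ge0// sqr_ge0.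
have ra0 : 0 <= ra by exact: sqrtr_ge0.
have rb0 : 0 <= rb by exact: sqrtr_ge0.
have dc : d ^+ 2 + c ^+ 2 = (ra * rb) ^+ 2 by rewrite exprMn ra2 rb2 /d /c; ring.
have rab : 0 < ra * rb.
  rewrite lt_neqAle mulr_ge0// andbT eq_sym; apply: contraTneq d0 => h.
  have : d ^+ 2 <= 0 by rewrite -[leRHS](expr0n _ 2) -h -dc lerDl sqr_ge0.
  by rewrite -leNgt => ?; have := sqr_ge0 d; nra.
have ra1 : 0 < ra by rewrite lt_neqAle ra0 andbT eq_sym; apply: contraTneq rab => ->; rewrite mul0r ltxx.
have rbn : rb != 0 by apply: contraTneq rab => ->; rewrite mulr0 ltxx.
have ran : ra != 0 by exact: lt0r_neq0.
have dn : d != 0 by exact: lt0r_neq0.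
set w := atan (c / d).
have cosw : cos w = d / (ra * rb).
  rewrite /w cos_atan.
  have -> : 1 + (c / d) ^+ 2 = (ra * rb / d) ^+ 2.
    by rewrite !expr_div_n -dc; field; exact: lt0r_neq0.
  by rewrite sqrtr_sqr ger0_norm ?invf_div// divr_ge0// ltW.
have sinw : sin w = c / (ra * rb).
  have := atanK (c / d); rewrite -/w /tan cosw => h.
  have : sin w = c / d * (d / (ra * rb)).
    by rewrite -h mulfVK// lt0r_neq0// divr_gt0.
  by move=> ->; field; rewrite rbn ran dn.
have ct : cos th = a1 / ra by rewrite {1}ha1; field.
have st : sin th = a2 / ra by rewrite {1}ha2; field.
have ran2 : a1 ^+ 2 + a2 ^+ 2 != 0 by rewrite -ra2 expf_neq0.
rewrite cosD sinD cosw sinw ct st; split.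
  transitivity ((a1 * d - a2 * c) / ra ^+ 2); last by field; rewrite ran rbn.
  by rewrite ra2 /d /c; field.
transitivity ((a2 * d + a1 * c) / ra ^+ 2); last by field; rewrite ran rbn.
by rewrite ra2 /d /c; field.
Qed.

Lemma angle_exists a1 a2 : exists th,
  a1 = Num.sqrt (a1 ^+ 2 + a2 ^+ 2) * cos th /\
  a2 = Num.sqrt (a1 ^+ 2 + a2 ^+ 2) * sin th.
Proof.
set r := Num.sqrt _.
have r2 : r ^+ 2 = a1 ^+ 2 + a2 ^+ 2 by rewrite sqr_sqrtr// addr_ge0// sqr_ge0.
have [r0|r0] := eqVneq r 0.
  exists 0; rewrite r0 !mul0r; move: r2; rewrite r0 expr0n => /esym/eqP.
  by rewrite paddr_eq0 ?sqr_ge0// !sqrf_eq0 => /andP[/eqP-> /eqP->].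
have r0' : 0 < r by rewrite lt_neqAle eq_sym r0 sqrtr_ge0.
have bnd : -1 <= a1 / r <= 1.
  rewrite -ler_norml normrM normfV (gtr0_norm r0') ler_pdivrMr// mul1r.
  by rewrite -ler_sqr ?nnegrE// ?(ltW r0')// real_normK ?num_real// r2 lerDl sqr_ge0.
have ca : cos (acos (a1 / r)) = a1 / r by rewrite acosK// in_itv.
have sa : sin (acos (a1 / r)) ^+ 2 = (a2 / r) ^+ 2.
  have := cos2Dsin2 (acos (a1 / r)); rewrite ca => h.
  have -> : sin (acos (a1 / r)) ^+ 2 = 1 - (a1 / r) ^+ 2 by lra.
  by rewrite !expr_div_n r2; field; rewrite -r2 expf_neq0.
have /orP[/eqP h|/eqP h] : (sin (acos (a1 / r)) == a2 / r) || (sin (acos (a1 / r)) == - (a2 / r)).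
- by rewrite -eqf_sqr sa.
- by exists (acos (a1 / r)); rewrite ca h; split; field.
- by exists (- acos (a1 / r)); rewrite cosN sinN ca h opprK; split; field.
Qed.

End Angles.

Section AngleLift.
Context {R : realType}.

Definition angle_of (a1 a2 th : R) : Prop :=
  a1 = Num.sqrt (a1 ^+ 2 + a2 ^+ 2) * cos th /\
  a2 = Num.sqrt (a1 ^+ 2 + a2 ^+ 2) * sin th.

Lemma angle_of_sin a1 a2 th th' : 0 < a1 ^+ 2 + a2 ^+ 2 ->
  angle_of a1 a2 th -> angle_of a1 a2 th' -> sin (th - th') = 0.
Proof.
rewrite /angle_of -sqrtr_gt0; set r := Num.sqrt _ => r0 [h1 h2] [h3 h4].
have rn : r != 0 by exact: lt0r_neq0.
have c : cos th = cos th' by apply: (mulfI rn); rewrite -h1 -h3.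
have s : sin th = sin th' by apply: (mulfI rn); rewrite -h2 -h4.
by rewrite sinB c s; ring.
Qed.

Variables f1 f2 : R * R -> R.
Hypothesis cf1 : continuous f1.
Hypothesis cf2 : continuous f2.
Hypothesis f0 : forall x, 0 < f1 x ^+ 2 + f2 x ^+ 2.

Let box (M : R) : set (R * R) := `[-M, M] `*` `[-M, M].

Let ray (s : R) (x : R * R) : R * R := (s * x.1, s * x.2).

Let dot (a b : R * R) : R := f1 a * f1 b + f2 a * f2 b.

(** By compactness of the box, a single step size works for all its rays. *)
Lemma ray_step M : exists2 e : R, 0 < e & forall (s s' : R) x,
  0 <= s <= 1 -> box M x -> `|s' - s| < e -> 0 < dot (ray s x) (ray s' x).
Proof.
pose K : set (R * (R * R)) := `[0, 1] `*` box M.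
have cK : compact K.
  by apply: compact_setX; [exact: segment_compact|apply: compact_setX; exact: segment_compact].
pose D (z : (R * (R * R)) * R) := dot (ray z.1.1 z.1.2) (ray z.2 z.1.2).
have cD : continuous D.
  rewrite /D /dot /ray.
  have c1 : continuous (fun z : (R * (R * R)) * R => (z.1.1 * z.1.2.1, z.1.1 * z.1.2.2)).
    by cont.
  have c2 : continuous (fun z : (R * (R * R)) * R => (z.2 * z.1.2.1, z.2 * z.1.2.2)).
    by cont.
  by cont; apply: cont_comp.
pose P (e : R) (z : R * (R * R)) := forall s', `|s' - z.1| < e -> 0 < D (z, s').
have /compact_near_coveringP/(_ R (0^'+) P) ncK := cK.
have [|e /= [e0 eP]] := (@filter_ex _ (0 : R)^'+ _ (fun e => 0 < e /\ K `<=` P e)).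
  apply: filterI; first exact: nbhs_right_gt.
  apply: ncK => -[s x] _.
  have Dp : 0 < D ((s, x), s) by rewrite /D /dot/= -!expr2.
  have /cvgr_gt/(_ _ Dp) := cD ((s, x), s).
  case=> -[/= A B] [nA /nbhs_ballP[eta /= eta0 Beta]] AB.
  have nA' : nbhs (s, x) [set z : R * (R * R) | A z /\ `|z.1 - s| < eta / 2].
    apply: filterI => //.
    have := @cont_fst R (R * R)%type (s, x).
    by move/cvgr_distC_lt; apply; rewrite divr_gt0.
  have nE : \forall e \near (0 : R)^'+, e < eta / 2.
    by apply: nbhs_right_lt; rewrite divr_gt0.
  exists ([set z : R * (R * R) | A z /\ `|z.1 - s| < eta / 2], [set e | e < eta / 2]) => //.
  move=> [z e] [/= [Az zs] ee] s' s'z; apply: (AB (z, s')); split => //=.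
  apply: Beta; rewrite /ball/=.
  rewrite (_ : s - s' = (z.1 - s') - (z.1 - s)); last by lra.
  rewrite (le_lt_trans (ler_normB _ _))//; rewrite distrC in s'z; lra.
exists e => // s s' x s01 xM ss'.
by apply: (eP (s, x)) => //; split.
Qed.

Variable th0 : R.
Hypothesis hth0 : angle_of (f1 (0, 0)) (f2 (0, 0)) th0.

(** Follow the angle along the ray from the origin to each point, in finitely
    many small steps: the result is a finite sum of arctangents, visibly
    continuous in the end point of the ray. *)
Lemma angle_lift_box M : 0 <= M -> exists th : R * R -> R,
  [/\ continuous th, th (0, 0) = th0 &
      forall x, box M x -> angle_of (f1 x) (f2 x) (th x)].
Proof.
move=> M0; have [e e0 he] := ray_step M.
pose N := (Num.trunc (e^-1)).+1.
have N0 : (0 : R) < N%:R by rewrite ltr0n.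
have Ne : N%:R^-1 < e.
  by rewrite -[ltRHS]invrK ltf_pV2 ?posrE ?invr_gt0//; exact: truncnS_gt.
pose c (x : R * R) := (clamp (- M) M x.1, clamp (- M) M x.2).
have cc : continuous c.
  by rewrite /c; cont; apply: cont_comp; try exact: clamp_cont; cont.
have cbox x : box M (c x).
  by split; rewrite /= in_itv/= clamp_in//; lra.
have cE x : box M x -> c x = x.
  by move=> []; rewrite /= !in_itv/= => h1 h2; rewrite /c !clamp_id//; case: (x).
pose p i x := ray (i%:R / N%:R) (c x).
have cp i : continuous (p i).
  rewrite /p /ray; have c1 : continuous (fun x => (c x).1).
    by apply: cont_comp => //; cont.
  have c2 : continuous (fun x => (c x).2) by cont.
  by cont.
pose cr (a b : R * R) : R := f1 a * f2 b - f2 a * f1 b.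
pose th k x := th0 + \sum_(i < k) atan (cr (p i x) (p i.+1 x) / dot (p i x) (p i.+1 x)).
have dp i x : (i < N)%N -> 0 < dot (p i x) (p i.+1 x).
  move=> iN; apply: he => //.
    by rewrite divr_ge0// ler_pdivrMr// mul1r ler_nat ltnW.
  rewrite -mulrBl -natrB//= subSnn mul1r gtr0_norm// invr_gt0//.
have thk k x : (k <= N)%N -> angle_of (f1 (p k x)) (f2 (p k x)) (th k x).
  elim: k => [|k IH] kN.
    by rewrite /th big_ord0 addr0 /p /ray !mul0r.
  have [h1 h2] := IH (ltnW kN).
  have := rotate_atan (dp k x kN) h1 h2.
  by rewrite /th big_ord_recr/= addrA.
have cth k : (k <= N)%N -> continuous (th k).
  elim: k => [|k IH] kN.
    rewrite (_ : th 0%N = fun=> th0); first by cont.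
    by apply/funext => x; rewrite /th big_ord0 addr0.
  have -> : th k.+1 = fun x => th k x + atan (cr (p k x) (p k.+1 x) / dot (p k x) (p k.+1 x)).
    by apply/funext => x; rewrite /th big_ord_recr/= addrA.
  apply: contD; first exact: IH (ltnW kN).
  apply: cont_comp; first by move=> y; exact: continuous_atan.
  have cf i : continuous (fun x => f1 (p i x)) by apply: cont_comp.
  have cg i : continuous (fun x => f2 (p i x)) by apply: cont_comp.
  apply: contM; first by rewrite /cr; cont; apply: cont_comp.
  apply: contV; first by move=> x; rewrite lt0r_neq0// dp.
  by rewrite /dot; cont; apply: cont_comp.
exists (th N); split; first exact: cth.
  rewrite /th big1 ?addr0// => i _.
  have p0 j : p j (0, 0) = (0, 0).
    by rewrite /p cE ?/ray/= ?mulr0//; split; rewrite /= in_itv/=; lra.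
  by rewrite !p0 (_ : cr _ _ = 0) ?mul0r ?atan0// /cr; ring.
move=> x /cE xE; have := thk N x (leqnn _).
by rewrite /p divff ?lt0r_neq0// /ray !mul1r xE; case: (x).
Qed.

End AngleLift.

Section GlobalLift.
Context {R : realType}.

(** The lifts on growing boxes agree because they agree at the origin, hence
    along every ray. *)
Lemma angle_lift (f1 f2 : R * R -> R) : continuous f1 -> continuous f2 ->
  (forall x, 0 < f1 x ^+ 2 + f2 x ^+ 2) ->
  exists2 th : R * R -> R, continuous th &
    forall x, angle_of (f1 x) (f2 x) (th x).
Proof.
move=> cf1 cf2 f0; have [th0 hth0] := angle_exists (f1 (0, 0)) (f2 (0, 0)).
have /choice[L HL] : forall n : nat, exists th : R * R -> R,
  [/\ continuous th, th (0, 0) = th0 &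
      forall x, (`[-(n%:R), n%:R] `*` `[-(n%:R), n%:R]) x -> angle_of (f1 x) (f2 x) (th x)].
  by move=> n; apply: angle_lift_box.
have agree m n (x : R * R) : (m <= n)%N -> (`[-(m%:R), m%:R] `*` `[-(m%:R), m%:R]) x -> L m x = L n x.
  move=> mn [/=]; rewrite !in_itv/= => /andP[x1 x1'] /andP[x2 x2'].
  have [cm m0 hm] := HL m; have [cn n0 hn] := HL n.
  have mnR : (m%:R : R) <= n%:R by rewrite ler_nat.
  pose g (s : R) := L m (s * x.1, s * x.2) - L n (s * x.1, s * x.2).
  have gc : continuous g by rewrite /g; cont; apply: cont_comp => //; cont.
  have : g 0 = g 1.
    apply: sin0_constant => // s /andP[s0 s1].
    have b1 : -m%:R <= s * x.1 <= m%:R by apply/andP; split; nra.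
    have b2 : -m%:R <= s * x.2 <= m%:R by apply/andP; split; nra.
    apply: angle_of_sin (f0 _) (hm _ _) (hn _ _).
      by split; rewrite /= in_itv/=.
    by split; rewrite /= in_itv/=; lra.
  by rewrite /g !mul0r m0 n0 subrr !mul1r => /esym/subr0_eq; case: (x) .
pose B (x : R * R) := (Num.trunc (`|x.1| + `|x.2|)).+1.
have Bx x : `|x.1| + `|x.2| < (B x)%:R by exact: truncnS_gt.
have inB n (x : R * R) : `|x.1| + `|x.2| < n%:R -> (`[-(n%:R), n%:R] `*` `[-(n%:R), n%:R]) x.
  move=> h; have n1 := normr_ge0 x.1; have n2 := normr_ge0 x.2.
  have /ler_normlP[] : `|x.1| <= n%:R by lra.
  have /ler_normlP[] : `|x.2| <= n%:R by lra.
  by move=> *; split; rewrite /= in_itv/=; lra.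
have LB n (x : R * R) : `|x.1| + `|x.2| < n%:R -> L (B x) x = L n x.
  move=> h; case/orP: (leq_total (B x) n) => bn; first exact/agree/inB.
  by apply/esym/agree => //; exact: inB.
exists (fun x => L (B x) x); last first.
  by move=> x; have [_ _] := HL (B x); apply; exact: inB.
move=> x; have [cB _ _] := HL (B x).
apply: cvg_trans (cB x); apply: near_eq_cvg.
have cn : continuous (fun y : R * R => `|y.1| + `|y.2|).
  by cont.
have /cvgr_lt/(_ _ (Bx x)) := cn x.
by apply: filterS => y yB; apply/esym/LB.
Qed.

End GlobalLift.

(** * Elliptic coordinates and their lifts *)

Section Joukowski.
Context {R : realType}.
Implicit Types (x y s r t : R) (X Y : R -> R).

(** The point [x + iy] is [(z + 1/z) / 2] with [z] of modulus [r] and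
    argument [s]. *)
Definition joukowski x y s r : Prop :=
  [/\ 0 < r, x = (r + r^-1) / 2 * cos s & y = (r - r^-1) / 2 * sin s].

(** A path from [-1] to [1] that reaches these points at its ends only. It is
    continued by constants out of [0, 1], so that continuity can be stated for
    total functions. *)
Definition normalized_arc X Y : Prop :=
  [/\ continuous X, continuous Y,
      forall t, t <= 0 -> X t = -1 /\ Y t = 0,
      forall t, 1 <= t -> X t = 1 /\ Y t = 0 &
      forall t, 0 < t < 1 -> X t ^+ 2 = 1 -> Y t != 0].

Lemma squeeze0_mul (T : topologicalType) (f g : T -> R) (x : T) :
  continuous f -> f x = 0 -> (forall y : T, `|g y| <= 1) ->
  f y * g y @[y --> x] --> f x * g x.
Proof.
move=> cf fx g1; rewrite fx mul0r; apply/cvgr0Pnorm_lt => e e0.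
have /cvgr0Pnorm_lt/(_ _ e0) : f y @[y --> x] --> (0 : R) by rewrite -fx; exact: cf.
apply: filterS => y; rewrite normrM; apply: le_lt_trans.
by rewrite ler_piMr.
Qed.

(** The interval ]0, 1[ is parametrized by the line, so as to lift over an
    open strip. *)
Let m t : R := 1 / 2 + t / (2 * (1 + `|t|)).
Let mi t : R := (2 * t - 1) / (1 - `|2 * t - 1|).

Let m_cont : continuous m.
Proof.
rewrite /m; cont; apply: contV; last by cont.
by move=> t; rewrite lt0r_neq0//; have := normr_ge0 t; lra.
Qed.

Let m_in t : 0 < m t < 1.
Proof.
have t0 := normr_ge0 t; have := ler_norm t; have := ler_norm (- t).
rewrite normrN => h1 h2.
have d0 : 0 < 2 * (1 + `|t|) by lra.
have a1 : t / (2 * (1 + `|t|)) < 1 / 2 by rewrite ltr_pdivrMr//; lra.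
have a2 : - (1 / 2) < t / (2 * (1 + `|t|)) by rewrite ltr_pdivlMr//; lra.
by rewrite /m; apply/andP; split; lra.
Qed.

Let mi_lt1 t : 0 < t < 1 -> `|2 * t - 1| < 1.
Proof. by move=> /andP[t0 t1]; rewrite ltr_norml; apply/andP; split; lra. Qed.

Let miK t : 0 < t < 1 -> m (mi t) = t.
Proof.
move=> /mi_lt1 h; rewrite /m /mi; set u := 2 * t - 1 in h *.
have u0 : 0 < 1 - `|u| by lra.
rewrite normrM normfV (gtr0_norm u0).
have -> : 1 + `|u| / (1 - `|u|) = (1 - `|u|)^-1 by field; exact: lt0r_neq0.
rewrite (_ : u / _ / _ = u / 2); first by rewrite /u; field.
by field; rewrite ?invr_eq0 lt0r_neq0.
Qed.

Let mi_cont t : 0 < t < 1 -> {for t, continuous mi}.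
Proof.
move=> /mi_lt1 h; rewrite /mi; apply: (@cvgM _ _ _ _ (fun t => 2 * t - 1)).
  have c : continuous (fun t : R => 2 * t - 1) by cont.
  exact: c.
apply: cvgV; first by rewrite lt0r_neq0// subr_gt0.
have c : continuous (fun t : R => 1 - `|2 * t - 1|) by cont.
exact: c.
Qed.

(** Half of a continuous angle of [p ^ 2 - 1] is the angle of a square root [q]
    of it, which tends to 0 where [p] reaches a branch point, and so is continuous
    there as well. Then [z := p + q] satisfies [p = (z + 1/z) / 2] because
    [(p + q) (p - q) = 1], hence never vanishes and has a continuous angle. *)
Lemma joukowski_lift (X Y : R * R -> R) : continuous X -> continuous Y ->
  (forall t u, ~~ (0 < t < 1) -> X (t, u) ^+ 2 = 1 /\ Y (t, u) = 0) ->
  (forall t u, 0 < t < 1 -> X (t, u) ^+ 2 = 1 -> Y (t, u) != 0) ->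
  exists s r : R * R -> R, [/\ continuous s, continuous r &
    forall z, joukowski (X z) (Y z) (s z) (r z)].
Proof.
move=> cX cY out inn.
pose f1 z := X z ^+ 2 - Y z ^+ 2 - 1; pose f2 z := 2 * X z * Y z.
pose n z := f1 z ^+ 2 + f2 z ^+ 2.
have cf1 : continuous f1 by rewrite /f1; cont.
have cf2 : continuous f2 by rewrite /f2; cont.
have nE z : n z = ((X z - 1) ^+ 2 + Y z ^+ 2) * ((X z + 1) ^+ 2 + Y z ^+ 2).
  by rewrite /n /f1 /f2; ring.
have n_ge0 z : 0 <= n z by rewrite addr_ge0// sqr_ge0.
have n_gt0 t u : 0 < t < 1 -> 0 < n (t, u).
  move=> t01; have := inn t u t01; set x := X _; set y := Y _ => h.
  rewrite nE -/x -/y; have [y0|y0] := eqVneq y 0.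
    rewrite y0 expr0n/= !addr0.
    have hx : (x - 1) * (x + 1) != 0.
      apply/eqP => e; suff /h : x ^+ 2 = 1 by rewrite y0 eqxx.
      by apply/eqP; rewrite -subr_eq0 -e; apply/eqP; ring.
    by move: hx; rewrite mulf_eq0 negb_or => /andP[x1 x2]; rewrite mulr_gt0// exprn_even_gt0.
  by rewrite mulr_gt0// ltr_wpDl ?sqr_ge0// exprn_even_gt0.
have n_out t u : ~~ (0 < t < 1) -> n (t, u) = 0.
  by move=> /(out _ u)[x1 y0]; rewrite /n /f1 /f2 y0 x1; ring.
pose mm (z : R * R) := (m z.1, z.2).
have cmm : continuous mm.
  by rewrite /mm; cont; apply: cont_comp; [exact: m_cont|cont].
have [||z|Th cTh hTh] := @angle_lift R (fun z => f1 (mm z)) (fun z => f2 (mm z)).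
- exact: cont_comp.
- exact: cont_comp.
- exact/n_gt0/m_in.
(* The square root [q] of [p ^ 2 - 1] has modulus [rt] and angle [H]. *)
pose rt z := Num.sqrt (Num.sqrt (n z)).
have crt : continuous rt.
  have cs : continuous (fun x : R => Num.sqrt x) by exact: sqrt_continuous.
  by rewrite /rt; do 2!apply: cont_comp => //; rewrite /n; cont.
have rt2 z : rt z ^+ 2 = Num.sqrt (n z) by rewrite sqr_sqrtr// sqrtr_ge0.
pose H (z : R * R) := Th (mi z.1, z.2) / 2.
pose q1 z := rt z * cos (H z); pose q2 z := rt z * sin (H z).
have rt0 z : ~~ (0 < z.1 < 1) -> rt z = 0.
  by case: z => t u h; rewrite /rt n_out// !sqrtr0.
have cH z : 0 < z.1 < 1 -> {for z, continuous H}.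
  move=> z01; apply: cvgM; last exact: cvg_cst.
  have h : (fun z : R * R => (mi z.1, z.2)) x @[x --> z] --> (mi z.1, z.2).
    have h1 : mi x.1 @[x --> z] --> mi z.1.
      exact: (continuous_comp (@cont_fst _ _ z) (mi_cont z01)).
    have h2 : x.2 @[x --> z] --> z.2 by exact: cont_snd.
    exact: (cvg_pair h1 h2).
  exact: (continuous_comp h (cTh _)).
have cq1 : continuous q1.
  move=> z; have [z01|z01] := boolP (0 < z.1 < 1).
    apply: cvgM; first exact: crt.
    exact: (continuous_comp (cH z z01) (@continuous_cos R _)).
  by apply: squeeze0_mul => //; [exact: rt0|move=> y; exact: cos_max].
have cq2 : continuous q2.
  move=> z; have [z01|z01] := boolP (0 < z.1 < 1).
    apply: cvgM; first exact: crt.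
    exact: (continuous_comp (cH z z01) (@continuous_sin R _)).
  by apply: squeeze0_mul => //; [exact: rt0|move=> y; exact: sin_max].
have qf z : q1 z ^+ 2 - q2 z ^+ 2 = f1 z /\ 2 * q1 z * q2 z = f2 z.
  have [z01|z01] := boolP (0 < z.1 < 1); last first.
    case: z z01 => t u z01; have [x1 y0] := out t u z01.
    by rewrite /q1 /q2 rt0//= /f1 /f2 x1 y0; split; ring.
  have := hTh (mi z.1, z.2); rewrite /mm/= miK//.
  have -> : (z.1, z.2) = z by case: (z).
  case; rewrite -/(n z) -rt2 -/(f1 z) -/(f2 z).
  have -> : Th (mi z.1, z.2) = H z *+ 2 by rewrite /H mulr2n; lra.
  rewrite mulr2n cosD sinD => e1 e2; rewrite {1}e1 {1}e2 /q1 /q2.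
  by split; ring.
pose z1 z := X z + q1 z; pose z2 z := Y z + q2 z.
have zw z : z1 z * (X z - q1 z) - z2 z * (Y z - q2 z) = 1.
  have [h1 _] := qf z; rewrite /z1 /z2.
  transitivity (X z ^+ 2 - Y z ^+ 2 - (q1 z ^+ 2 - q2 z ^+ 2)); first by ring.
  by rewrite h1 /f1; ring.
have zw' z : z1 z * (Y z - q2 z) + z2 z * (X z - q1 z) = 0.
  have [_ h1] := qf z; rewrite /z1 /z2.
  transitivity (2 * X z * Y z - 2 * q1 z * q2 z); first by ring.
  by rewrite h1 /f2; ring.
have z0 z : 0 < z1 z ^+ 2 + z2 z ^+ 2.
  rewrite lt_neqAle addr_ge0 ?sqr_ge0// andbT eq_sym paddr_eq0 ?sqr_ge0//.
  rewrite !sqrf_eq0; apply/negP => /andP[/eqP h1 /eqP h2].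
  by have /eqP := zw z; rewrite h1 h2 !mul0r subr0 eq_sym oner_eq0.
have [||//|s cs hs] := @angle_lift R z1 z2.
- by rewrite /z1; cont.
- by rewrite /z2; cont.
pose r z := Num.sqrt (z1 z ^+ 2 + z2 z ^+ 2).
have r2 z : r z ^+ 2 = z1 z ^+ 2 + z2 z ^+ 2 by rewrite sqr_sqrtr// ltW.
exists s, r; split => //.
  have cs' : continuous (fun x : R => Num.sqrt x) by exact: sqrt_continuous.
  by apply: cont_comp => //; rewrite /z1 /z2; cont.
move=> z; have r0 : 0 < r z by rewrite sqrtr_gt0.
have rn : r z != 0 by exact: lt0r_neq0.
have [e1 e2] := hs z.
have w1 : X z - q1 z = z1 z / r z ^+ 2.
  apply: (mulIf (lt0r_neq0 (z0 z))); rewrite -r2 mulfVK ?expf_neq0// r2.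
  have := zw z; have := zw' z; move: (X z - q1 z) (Y z - q2 z) => a b h1 h2.
  transitivity (z1 z * (z1 z * a - z2 z * b) + z2 z * (z1 z * b + z2 z * a)); first by ring.
  by rewrite h1 h2; ring.
have w2 : Y z - q2 z = - z2 z / r z ^+ 2.
  apply: (mulIf (lt0r_neq0 (z0 z))); rewrite -r2 mulfVK ?expf_neq0// r2.
  have := zw z; have := zw' z; move: (X z - q1 z) (Y z - q2 z) => a b h1 h2.
  transitivity (z1 z * (z1 z * b + z2 z * a) - z2 z * (z1 z * a - z2 z * b)); first by ring.
  by rewrite h1 h2; ring.
rewrite -/(r z) in e1 e2.
split => //.
  transitivity ((z1 z + (X z - q1 z)) / 2); first by rewrite /z1; field.
  by rewrite w1 e1; field.
transitivity ((z2 z + (Y z - q2 z)) / 2); first by rewrite /z2; field.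
by rewrite w2 e2; field.
Qed.

End Joukowski.

(** * The turning of a plane arc *)

Section Turning.
Context {R : realType}.
Implicit Types (x y s r t u : R) (X Y : R -> R).

Definition joukowski_path X Y (s r : R -> R) : Prop :=
  [/\ continuous s, continuous r & forall t, joukowski (X t) (Y t) (s t) (r t)].

(** The total variation of the argument of [z]. Its sign depends on the lift,
    since [z] and [1/z] lie over the same point; the absolute value does not
    ([turning_uniq]). *)
Definition turning X Y (J : R) : Prop :=
  exists s r : R -> R, joukowski_path X Y s r /\ J = `|s 1 - s 0|.

(** If the imaginary part vanishes with [sin s != 0], then [r = 1], so that
    [x = cos s] lies strictly between the branch points. *)
Lemma joukowski_real x s r : 1 <= x ^+ 2 -> joukowski x 0 s r -> sin s = 0.
Proof.
move=> x2 [r0 hx hy]; have rn := lt0r_neq0 r0.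
have cs := cos2Dsin2 s.
apply/eqP; apply: contraT => sn; move/esym/eqP: hy.
rewrite mulf_eq0 (negbTE sn) orbF mulf_eq0 invr_eq0 pnatr_eq0 orbF subr_eq0 => /eqP rr.
have r1 : r = 1.
  have : r * r = 1 by rewrite {2}rr mulfV.
  by move=> h; nra.
move: hx; rewrite r1 invr1 (_ : (1 + 1) / 2 = 1) ?mul1r; last by field.
move=> xc; have s2 : sin s ^+ 2 <= 0 by rewrite -xc in cs; lra.
by move: s2; rewrite le_eqVlt ltNge sqr_ge0 orbF sqrf_eq0 (negbTE sn).
Qed.

Lemma joukowski_branch x s r : x ^+ 2 = 1 -> joukowski x 0 s r ->
  sin s = 0 /\ cos s = x.
Proof.
move=> x2 hz; have s0 : sin s = 0 by apply: joukowski_real hz; rewrite x2.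
have [r0 hx _] := hz; have rn := lt0r_neq0 r0; have cs := cos2Dsin2 s.
split => //; move: cs; rewrite s0 expr0n/= addr0 => c2.
have ge1 : 1 <= (r + r^-1) / 2.
  have := sqr_ge0 (r - 1) => h.
  rewrite ler_pdivlMr// -subr_ge0.
  have -> : r + r^-1 - 1 * 2 = (r - 1) ^+ 2 / r by field.
  by rewrite divr_ge0// ltW.
have : ((r + r^-1) / 2) ^+ 2 = 1.
  by rewrite -[RHS]x2 hx [RHS]exprMn c2 mulr1.
move=> e; have {}e : (r + r^-1) / 2 = 1 by nra.
by rewrite hx e mul1r.
Qed.

(** The ends of a lift stay over the branch points during a homotopy, so they
    do not move. *)
Lemma turning_homotopy (X Y : R * R -> R) : continuous X -> continuous Y ->
  (forall u, normalized_arc (fun t => X (t, u)) (fun t => Y (t, u))) ->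
  exists J, turning (fun t => X (t, 0)) (fun t => Y (t, 0)) J /\
            turning (fun t => X (t, 1)) (fun t => Y (t, 1)) J.
Proof.
move=> cX cY XY.
have [||s [r [cs cr hsr]]] := joukowski_lift cX cY.
- move=> t u t01; have [_ _ a b _] := XY u.
  have [t0|t0] := leP t 0; first by have [-> ->] := a t t0; split => //; ring.
  have t1 : 1 <= t by rewrite leNgt; move: t01; rewrite t0.
  by have [-> ->] := b t t1; split => //; ring.
- by move=> t u t01; have [_ _ _ _ c] := XY u; exact: c.
have c1 (f : R * R -> R) u : continuous f -> continuous (fun t => f (t, u)).
  by move=> cf; apply: (cont_comp cf); cont.
have c2 (f : R * R -> R) t : continuous f -> continuous (fun u => f (t, u)).
  by move=> cf; apply: (cont_comp cf); cont.
have e0 : s (0, 0) = s (0, 1).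
  apply: (@sin0_constant R (fun u => s (0, u))) => //; first exact: c2.
  move=> u _; have [_ _ /(_ 0 (lexx _))[h1 h2] _ _] := XY u.
  by have := hsr (0, u); rewrite h1 h2 => /joukowski_branch[]//; ring.
have e1 : s (1, 0) = s (1, 1).
  apply: (@sin0_constant R (fun u => s (1, u))) => //; first exact: c2.
  move=> u _; have [_ _ _ /(_ 1 (lexx _))[h1 h2] _] := XY u.
  by have := hsr (1, u); rewrite h1 h2 => /joukowski_branch[]//; ring.
exists `|s (1, 0) - s (0, 0)|; split.
  exists (fun t => s (t, 0)), (fun t => r (t, 0)); split => //.
  by split; [exact: c1|exact: c1|move=> t; exact: hsr].
exists (fun t => s (t, 1)), (fun t => r (t, 1)); split; last by rewrite e0 e1.
by split; [exact: c1|exact: c1|move=> t; exact: hsr].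
Qed.

Lemma turning_reparam X Y J (phi : R -> R) : continuous phi ->
  phi 0 = 0 -> phi 1 = 1 -> turning X Y J ->
  turning (X \o phi) (Y \o phi) J.
Proof.
move=> cphi p0 p1 [s [r [[cs cr h] ->]]].
exists (s \o phi), (r \o phi); split; last by rewrite /= p0 p1.
by split; [exact: cont_comp|exact: cont_comp|move=> t; exact: h].
Qed.

(** [q1 + i q2] is the square root [(z - 1/z) / 2] of [p ^ 2 - 1]. *)
Let q1 s r := (r - r^-1) / 2 * cos s.
Let q2 s r := (r + r^-1) / 2 * sin s.

Let q_square x y s r : joukowski x y s r ->
  q1 s r ^+ 2 - q2 s r ^+ 2 = x ^+ 2 - y ^+ 2 - 1 /\
  q1 s r * q2 s r = x * y.
Proof.
case=> r0 hx hy; rewrite -(cos2Dsin2 s) hx hy /q1 /q2.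
by split; field; exact: lt0r_neq0.
Qed.

Let joukowski_inj x y s r s' r' : joukowski x y s r -> joukowski x y s' r' ->
  q1 s r = q1 s' r' -> q2 s r = q2 s' r' -> sin (s - s') = 0.
Proof.
case=> r0 hx hy [r0' hx' hy'] h1 h2.
have e1 : r * cos s = r' * cos s'.
  transitivity (x + q1 s r); first by rewrite hx /q1; field; exact: lt0r_neq0.
  by rewrite h1 hx' /q1; field; exact: lt0r_neq0.
have e2 : r * sin s = r' * sin s'.
  transitivity (y + q2 s r); first by rewrite hy /q2; field; exact: lt0r_neq0.
  by rewrite h2 hy' /q2; field; exact: lt0r_neq0.
have rn : r * r' != 0 by rewrite mulf_neq0// lt0r_neq0.
apply: (mulfI rn); rewrite mulr0 sinB.
transitivity ((r * sin s) * (r' * cos s') - (r * cos s) * (r' * sin s')); first by ring.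
by rewrite e1 e2; ring.
Qed.

Lemma joukowskiV x y s r : joukowski x y s r -> joukowski x y (- s) r^-1.
Proof.
by case=> r0 -> ->; split; rewrite ?invr_gt0// ?invrK ?cosN ?sinN; ring.
Qed.

(** Over the interior of the arc the two square roots of [p ^ 2 - 1] are
    distinct, so that a lift cannot pass continuously from one to the other: two lifts have
    equal or inverse [z] all along, and their arguments have a constant
    difference or a constant sum. *)
Lemma turning_uniq X Y J J' : normalized_arc X Y ->
  turning X Y J -> turning X Y J' -> J = J'.
Proof.
move=> [cX cY X0 X1 Xin] [s [r [[cs cr h] ->]]] [s' [r' [[cs' cr' h'] ->]]].
have rn t : r t != 0 by have [/lt0r_neq0] := h t.
have rn' t : r' t != 0 by have [/lt0r_neq0] := h' t.
pose Q1 t := q1 (s t) (r t); pose Q2 t := q2 (s t) (r t).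
pose Q1' t := q1 (s' t) (r' t); pose Q2' t := q2 (s' t) (r' t).
pose g t := Q1 t * Q1' t + Q2 t * Q2' t.
have cosc (f : R -> R) : continuous f -> continuous (fun t => cos (f t)).
  by move=> cf; exact: (cont_comp (@continuous_cos R) cf).
have sinc (f : R -> R) : continuous f -> continuous (fun t => sin (f t)).
  by move=> cf; exact: (cont_comp (@continuous_sin R) cf).
have cg : continuous g.
  have := cosc _ cs; have := cosc _ cs'; have := sinc _ cs; have := sinc _ cs'.
  have := contV rn cr; have := contV rn' cr' => h1 h2 h3 h4 h5 h6.
  by rewrite /g /Q1 /Q2 /Q1' /Q2' /q1 /q2; cont.
(* The sign of [g] tells which of the two alternatives holds. *)
have alt t : (Q1 t = Q1' t /\ Q2 t = Q2' t) \/ (Q1 t = - Q1' t /\ Q2 t = - Q2' t).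
  have [a1 a2] := q_square (h t); have [b1 b2] := q_square (h' t).
  rewrite -/(Q1 t) -/(Q2 t) in a1 a2; rewrite -/(Q1' t) -/(Q2' t) in b1 b2.
  have /eqP : ((Q1 t - Q1' t) ^+ 2 + (Q2 t - Q2' t) ^+ 2) *
              ((Q1 t + Q1' t) ^+ 2 + (Q2 t + Q2' t) ^+ 2) = 0.
    transitivity ((Q1 t ^+ 2 - Q2 t ^+ 2 - (Q1' t ^+ 2 - Q2' t ^+ 2)) ^+ 2 +
        (2 * (Q1 t * Q2 t - Q1' t * Q2' t)) ^+ 2); first by ring.
    by rewrite a1 a2 b1 b2; ring.
  rewrite mulf_eq0 => /orP[]; rewrite paddr_eq0 ?sqr_ge0// !sqrf_eq0.
    by rewrite !subr_eq0 => /andP[/eqP-> /eqP->]; left.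
  by rewrite !addr_eq0 => /andP[/eqP-> /eqP->]; right.
have gn t : 0 < t < 1 -> g t != 0.
  move=> t01; have q0 : 0 < Q1 t ^+ 2 + Q2 t ^+ 2.
    rewrite lt_neqAle addr_ge0 ?sqr_ge0// andbT eq_sym paddr_eq0 ?sqr_ge0// !sqrf_eq0.
    apply/negP => /andP[/eqP h1 /eqP h2].
    have := q_square (h t); rewrite -/(Q1 t) -/(Q2 t) h1 h2 => -[e1 e2].
    have y0 : Y t = 0.
      apply/eqP; apply: contraT => yn; move/esym/eqP: e2; rewrite mul0r mulf_eq0 (negbTE yn) orbF => /eqP x0.
      by move: e1; rewrite x0 expr0n/= => e1; have := sqr_ge0 (Y t); lra.
    have := Xin t t01; rewrite y0 eqxx => /(_ _)/notF; apply.
    by move: e1; rewrite y0 expr0n/= => e1; lra.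
  rewrite /g; case: (alt t) => -[e1 e2].
    by rewrite -e1 -e2 -!expr2 lt0r_neq0.
  by rewrite e1 e2 in q0 *; rewrite !sqrrN in q0; rewrite !mulNr -opprD oppr_eq0 -!expr2 lt0r_neq0.
have gsign : (forall t, 0 < t < 1 -> 0 < g t) \/ (forall t, 0 < t < 1 -> g t < 0).
  have key (a b : R) : 0 < a < 1 -> 0 < b < 1 -> 0 < g a -> 0 < g b.
    move=> a01 b01 ga; rewrite ltNge; apply/negP => gb.
    have [c cab gc] : exists2 c, 0 < c < 1 & g c = 0.
      have [ab'|ba] := leP a b.
        have [|c + gc] := @IVT R g a b 0 ab' (continuous_subspaceT cg).
          by rewrite ge_min le_max gb (ltW ga) orbT.
        rewrite in_itv/= => /andP[h1 h2]; exists c => //.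
        by case/andP: a01 => ? ?; case/andP: b01 => ? ?; apply/andP; split; lra.
      have [|c + gc] := @IVT R g b a 0 (ltW ba) (continuous_subspaceT cg).
        by rewrite ge_min le_max gb (ltW ga) orbT.
      rewrite in_itv/= => /andP[h1 h2]; exists c => //.
      by case/andP: a01 => ? ?; case/andP: b01 => ? ?; apply/andP; split; lra.
    by have := gn c cab; rewrite gc eqxx.
  pose c : R := 1 / 2.
  have half : 0 < c < 1 by rewrite /c; lra.
  have [gh|gh] := ltP 0 (g c); first by left => t t01; exact: key gh.
  right => t t01; rewrite lt_neqAle gn//= leNgt; apply/negP => gt.
  by have := key _ _ t01 half gt; rewrite ltNge gh.
have ends t : (t == 0) || (t == 1) -> sin (s t) = 0 /\ sin (s' t) = 0.
  have X0' := X0 0 (lexx _); have X1' := X1 1 (lexx _).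
  case/orP => /eqP ->; split.
  - by have := h 0; case: X0' => -> -> /joukowski_branch[]//; ring.
  - by have := h' 0; case: X0' => -> -> /joukowski_branch[]//; ring.
  - by have := h 1; case: X1' => -> -> /joukowski_branch[]//; ring.
  - by have := h' 1; case: X1' => -> -> /joukowski_branch[]//; ring.
have inside t : 0 <= t <= 1 -> (t == 0) || (t == 1) \/ 0 < t < 1.
  move=> /andP[]; rewrite le_eqVlt eq_sym => /orP[->|t0]; first by left.
  by rewrite le_eqVlt => /orP[->|t1]; [left; rewrite orbT|right; rewrite t0].
have ssign (e : R) t : e ^+ 2 = 1 -> (0 < t < 1 -> e = 1 /\ 0 < g t \/ e = -1 /\ g t < 0) ->
    0 <= t <= 1 -> sin (s t - e * s' t) = 0.
  move=> e2 hg /inside[/ends[s0 s0']|/hg[]].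
  - rewrite sinB s0 mul0r sub0r; have /eqP : e ^+ 2 = 1 by [].
    rewrite sqrf_eq1 => /orP[] /eqP ->.
      by rewrite mul1r s0' mulr0 oppr0.
    by rewrite mulN1r sinN s0' oppr0 mulr0 oppr0.
  - move=> [-> gt]; rewrite mul1r; apply: joukowski_inj (h t) (h' t) _ _.
      case: (alt t) => -[]// e1 e2'; exfalso; move: gt; rewrite /g e1 e2'.
      by have := sqr_ge0 (Q1' t); have := sqr_ge0 (Q2' t); nra.
    case: (alt t) => -[]// e1 e2'; exfalso; move: gt; rewrite /g e1 e2'.
    by have := sqr_ge0 (Q1' t); have := sqr_ge0 (Q2' t); nra.
  - move=> [-> gt]; rewrite mulN1r; apply: joukowski_inj (h t) (joukowskiV (h' t)) _ _.
      have -> : q1 (- s' t) (r' t)^-1 = - Q1' t by rewrite /Q1' /q1 cosN invrK; ring.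
      case: (alt t) => -[]// e1 e2'; exfalso; move: gt; rewrite /g e1 e2'.
      by have := sqr_ge0 (Q1' t); have := sqr_ge0 (Q2' t); nra.
    have -> : q2 (- s' t) (r' t)^-1 = - Q2' t by rewrite /Q2' /q2 sinN invrK; ring.
    case: (alt t) => -[]// e1 e2'; exfalso; move: gt; rewrite /g e1 e2'.
    by have := sqr_ge0 (Q1' t); have := sqr_ge0 (Q2' t); nra.
case: gsign => gs.
  have : s 0 - 1 * s' 0 = s 1 - 1 * s' 1.
    apply: (@sin0_constant R (fun t => s t - 1 * s' t)) => //; first by cont.
    by move=> t; apply: ssign => [|t01]; [ring|left; split => //; exact: gs].
  by move=> e; congr (`|_|); lra.
have : s 0 - -1 * s' 0 = s 1 - -1 * s' 1.
  apply: (@sin0_constant R (fun t => s t - -1 * s' t)) => //; first by cont.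
  by move=> t; apply: ssign => [|t01]; [ring|right; split => //; exact: gs].
by move=> e; rewrite -[RHS]normrN; congr (`|_|); lra.
Qed.

End Turning.

(** * Turning of polygonal arcs *)

Section Sticks.
Context {R : realType}.
Implicit Types (x y s r t u a b c : R) (X Y : R -> R).

Lemma joukowski_sin0 x y s r : sin s = 0 -> joukowski x y s r ->
  y = 0 /\ 1 <= x ^+ 2.
Proof.
move=> s0 [r0 -> ->]; rewrite s0 mulr0; split => //.
have := cos2Dsin2 s; rewrite s0 expr0n/= addr0 exprMn => ->; rewrite mulr1.
have rn := lt0r_neq0 r0.
have -> : ((r + r^-1) / 2) ^+ 2 = 1 + ((r - r^-1) / 2) ^+ 2 by field.
by rewrite lerDl sqr_ge0.
Qed.

Lemma less_than_half_turn (f : R -> R) a b c : continuous f -> a <= b ->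
  (forall t u, a <= t <= b -> a <= u <= b -> sin (f t) = 0 -> sin (f u) = 0 ->
     f t = f u) ->
  sin c = 0 -> f a <= c -> f b < c + pi.
Proof.
move=> cf ab h c0 fa; have pi0 := pi_gt0 R; rewrite ltNge; apply/negP => fb.
have ivt v : f a <= v <= f b -> exists2 t, a <= t <= b & f t = v.
  move=> /andP[v1 v2]; have [|t] := @IVT R f a b v ab (continuous_subspaceT cf).
    by rewrite ge_min le_max v1 v2 orbT.
  by rewrite in_itv/=; exists t.
have [|t tab ft] := ivt c; first by rewrite fa/=; lra.
have [|u uab fu] := ivt (c + pi); first by apply/andP; split; lra.
have := h t u tab uab; rewrite ft fu c0 sinDpi c0 oppr0 => /(_ erefl erefl); lra.
Qed.

Definition affine_on (f : R -> R) a b : Prop := forall u, 0 <= u <= 1 ->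
  f ((1 - u) * a + u * b) = (1 - u) * f a + u * f b.

Lemma affine_onE f a b : a < b -> affine_on f a b ->
  exists al be, forall t, a <= t <= b -> f t = al + be * t.
Proof.
move=> ab h; have ba : 0 < b - a by lra.
have bn := lt0r_neq0 ba.
exists (f a - (f b - f a) / (b - a) * a), ((f b - f a) / (b - a)) => t /andP[t1 t2].
have u01 : 0 <= (t - a) / (b - a) <= 1.
  by apply/andP; split; [apply: divr_ge0; lra|rewrite ler_pdivrMr//; lra].
have := h _ u01.
rewrite (_ : (1 - (t - a) / (b - a)) * a + _ = t); last by field.
by move=> ->; field.
Qed.

(** On a stick [p] is affine, so that two points of it on the real axis force it
    to be real in between. It cannot pass from one side of the branch points to
    the other, as it reaches them at the times 0 and 1 only, which the stick does
    not both contain. So it stays where the argument of [z] is a multiple of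
    [pi]. *)
Lemma stick_crossing X Y (s r : R -> R) a b : normalized_arc X Y ->
  joukowski_path X Y s r -> a < b -> 0 <= a -> b <= 1 -> 0 < a \/ b < 1 ->
  affine_on X a b -> affine_on Y a b ->
  forall t u, a <= t <= b -> a <= u <= b -> sin (s t) = 0 -> sin (s u) = 0 ->
     s t = s u.
Proof.
move=> [cX cY X0 X1 Xin] [cs cr h] ab a0 b1 ab01 aX aY.
have [al [be hX]] := affine_onE ab aX; have [ga [de hY]] := affine_onE ab aY.
suff key t u : a <= t <= b -> a <= u <= b -> t < u -> sin (s t) = 0 -> sin (s u) = 0 ->
    s t = s u.
  move=> t u ht hu st su; have [tu|ut|->//] := ltgtP t u; first exact: key.
  exact/esym/key.
move=> ht hu tu st su; have /andP[t1 t2] := ht; have /andP[u1 u2] := hu.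
have [yt xt] := joukowski_sin0 st (h t); have [yu xu] := joukowski_sin0 su (h u).
have y0 v : t <= v <= u -> Y v = 0.
  move=> /andP[v1 v2]; rewrite hY; last by apply/andP; split; lra.
  move: yt yu; rewrite !hY// => e1 e2.
  have : de * (u - t) = 0 by lra.
  move/eqP; rewrite mulf_eq0 subr_eq0 (gt_eqF tu) orbF => /eqP d0.
  by move: e1; rewrite d0 !mul0r.
apply: (sin0_constant cs (ltW tu)) => v vtu; apply: joukowski_real (_ : 1 <= X v ^+ 2) _; last first.
  by have := h v; rewrite y0//; exact.
have /andP[v1 v2] := vtu.
have vab : a <= v <= b by apply/andP; split; lra.
have ends w w' : t <= w <= u -> t <= w' <= u -> X w = 1 -> X w' = -1 -> False.
  move=> hw hw' e1 e2; have /andP[w1 w2] := hw; have /andP[w1' w2'] := hw'.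
  have wn p : t <= p <= u -> X p ^+ 2 = 1 -> ~~ (0 < p < 1).
    by move=> hp e; apply/negP => p01; have := Xin p p01 e; rewrite (y0 p hp) eqxx.
  have : ~~ (0 < w < 1) by apply: wn => //; rewrite e1; ring.
  have : ~~ (0 < w' < 1) by apply: wn => //; rewrite e2; ring.
  rewrite !negb_and -!leNgt => /orP[p1|p1] /orP[p2|p2].
  - by have [] := X0 w p2; lra.
  - have : 0 < a \/ b < 1 := ab01; lra.
  - have : 0 < a \/ b < 1 := ab01; lra.
  - by have [] := X1 w' p1; lra.
have ivt z : Num.min (X t) (X u) <= z <= Num.max (X t) (X u) -> exists2 w, t <= w <= u & X w = z.
  move=> hz; have [w] := @IVT R X t u z (ltW tu) (continuous_subspaceT cX) hz.
  by rewrite in_itv/=; exists w.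
have sq1 x : 1 <= x ^+ 2 -> x <= -1 \/ 1 <= x.
  by move=> hx; have [hh|hh] := leP x (-1); [left|right; nra].
have Xv := hX v vab; have Xt := hX t ht; have Xu := hX u hu.
have [xt1|xt1] := sq1 _ xt; have [xu1|xu1] := sq1 _ xu.
- have : X v <= -1.
    have : (X v - X t) * (u - v) = (X u - X v) * (v - t) by rewrite Xv Xt Xu; ring.
    nra.
  by move=> ?; nra.
- have [|w hw e1] := ivt 1; first by rewrite ge_min le_max; apply/andP; split; apply/orP; lra.
  have [|w' hw' e2] := ivt (-1); first by rewrite ge_min le_max; apply/andP; split; apply/orP; lra.
  by case: (ends w w').
- have [|w hw e1] := ivt 1; first by rewrite ge_min le_max; apply/andP; split; apply/orP; lra.
  have [|w' hw' e2] := ivt (-1); first by rewrite ge_min le_max; apply/andP; split; apply/orP; lra.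
  by case: (ends w w').
- have : 1 <= X v.
    have : (X v - X t) * (u - v) = (X u - X v) * (v - t) by rewrite Xv Xt Xu; ring.
    nra.
  by move=> ?; nra.
Qed.

Lemma sin_add_natpi c n : sin c = 0 -> sin (c + n%:R * pi) = 0.
Proof.
move=> c0; elim: n => [|n IH]; first by rewrite mul0r addr0.
by rewrite -natr1 mulrDl mul1r addrA sinDpi IH oppr0.
Qed.

(** The argument of [z] has varied by less than [i * pi] after [i] sticks: in
    order to exceed the next bound, the following stick would have to reach two
    distinct multiples of [pi]. *)
Lemma turning_sticks X Y J n (b : nat -> R) : normalized_arc X Y ->
  (1 < n)%N -> b 0%N = 0 -> b n = 1 ->
  (forall i, (i < n)%N ->
     [/\ b i < b i.+1, affine_on X (b i) (b i.+1) & affine_on Y (b i) (b i.+1)]) ->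
  turning X Y J -> J < n%:R * pi.
Proof.
move=> nXY n1 b0 bn hb [s [r [lift ->]]].
have [cX cY X0 X1 Xin] := nXY; have [cs cr h] := lift.
have pi0 := pi_gt0 R.
have mono i j : (i <= j)%N -> (j <= n)%N -> b i <= b j.
  elim: j => [|j IH]; first by rewrite leqn0 => /eqP->.
  rewrite leq_eqVlt => /orP[/eqP->//|ij jn].
  by apply: le_trans (IH ij (ltnW jn)) _; have [/ltW] := hb j jn.
have s0 : sin (s 0) = 0.
  have [e1 e2] := X0 0 (lexx _).
  by have := h 0; rewrite e1 e2 => /joukowski_branch[]//; ring.
have cross i : (i < n)%N -> forall t u, b i <= t <= b i.+1 -> b i <= u <= b i.+1 ->
    sin (s t) = 0 -> sin (s u) = 0 -> s t = s u.
  move=> iN; have [bi aX aY] := hb i iN.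
  apply: (stick_crossing nXY lift) => //.
  - by rewrite -b0 mono// ltnW.
  - by rewrite -bn mono.
  - have [->|i0] := posnP i.
      right; have [lt1 _ _] := hb 1%N n1; rewrite -bn; apply: lt_le_trans lt1 _.
      exact: mono.
    left; have [lt1 _ _] := hb 0%N (ltnW n1); rewrite -b0; apply: lt_le_trans lt1 _.
    by apply: mono => //; exact: ltnW.
suff claim i : (i <= n)%N -> `|s (b i) - s 0| <= i%:R * pi /\
    ((0 < i)%N -> `|s (b i) - s 0| < i%:R * pi).
  by have [_] := claim n (leqnn _); rewrite bn; apply; exact: ltnW.
elim: i => [|i IH] iN; first by rewrite b0 subrr normr0 mul0r.
have [le _] := IH (ltnW iN).
have [bi _ _] := hb i iN.
suff lt : `|s (b i.+1) - s 0| < i.+1%:R * pi by split => //; exact: ltW.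
move: le; rewrite ler_norml ltr_norml -natr1 mulrDl mul1r => /andP[l1 l2].
apply/andP; split.
  have : - s (b i.+1) < (- s 0 + i%:R * pi) + pi.
    apply: (@less_than_half_turn (fun t => - s t) (b i)) => //; first by cont.
    - exact: ltW.
    - move=> t u ht hu; rewrite !sinN => /eqP; rewrite oppr_eq0 => /eqP e1 /eqP.
      by rewrite oppr_eq0 => /eqP e2; rewrite (cross i iN t u).
    - by apply: sin_add_natpi; rewrite sinN s0 oppr0.
    - lra.
  lra.
have : s (b i.+1) < (s 0 + i%:R * pi) + pi.
  apply: (@less_than_half_turn s (b i)) => //.
  - exact: ltW.
  - exact: cross.
  - exact: sin_add_natpi.
  - lra.
lra.
Qed.

End Sticks.

(** * Turning and winding number *)

Section OneSidedNeighbourhoods.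
Context {R : realType}.
Implicit Types (a : R) (P : set R).

Lemma at_right_ex a P : (\forall t \near a^'+, P t) ->
  exists2 e : R, 0 < e & forall t, a < t < a + e -> P t.
Proof.
case/nbhs_ballP => e /= e0 h; exists e => // t /andP[at1 te].
by apply: h => //=; rewrite /ball/= distrC gtr0_norm; lra.
Qed.

Lemma at_left_ex a P : (\forall t \near a^'-, P t) ->
  exists2 e : R, 0 < e & forall t, a - e < t < a -> P t.
Proof.
case/nbhs_ballP => e /= e0 h; exists e => // t /andP[at1 te].
by apply: h => //=; rewrite /ball/= gtr0_norm; lra.
Qed.

Lemma nbhs_dist_ex a P : (\forall t \near a, P t) ->
  exists2 e : R, 0 < e & forall t, `|t - a| < e -> P t.
Proof.
by case/nbhs_ballP => e /= e0 h; exists e => // t te; apply: h; rewrite /ball/= distrC.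
Qed.

End OneSidedNeighbourhoods.

Section Winding.
Context {R : realType}.
Implicit Types (x s r t u a b c : R) (X Y : R -> R).

(** [1 - 2 (a / b)] for complex [a] and [b]: the coordinate of [H + a] after
    the similarity that moves [H + b] to [-1] and [H] to [1]. *)
Definition frameX (a1 a2 b1 b2 : R) : R :=
  1 - 2 * (a1 * b1 + a2 * b2) / (b1 ^+ 2 + b2 ^+ 2).
Definition frameY (a1 a2 b1 b2 : R) : R :=
  - 2 * (a2 * b1 - a1 * b2) / (b1 ^+ 2 + b2 ^+ 2).

Lemma frameXY_self b1 b2 : 0 < b1 ^+ 2 + b2 ^+ 2 ->
  frameX b1 b2 b1 b2 = -1 /\ frameY b1 b2 b1 b2 = 0.
Proof. by move=> /lt0r_neq0 b0; rewrite /frameX /frameY; split; field. Qed.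

Lemma frameXY_0 b1 b2 : frameX 0 0 b1 b2 = 1 /\ frameY 0 0 b1 b2 = 0.
Proof. by rewrite /frameX /frameY !mul0r addr0 subr0 !mulr0 !mul0r subr0. Qed.

Lemma frameY_eq0 a1 a2 b1 b2 : 0 < b1 ^+ 2 + b2 ^+ 2 -> frameY a1 a2 b1 b2 = 0 ->
  let l := (1 - frameX a1 a2 b1 b2) / 2 in a1 = l * b1 /\ a2 = l * b2.
Proof.
move=> b0; have bn := lt0r_neq0 b0; rewrite /frameY /frameX => /eqP.
rewrite mulf_eq0 invr_eq0 (negbTE bn) orbF mulf_eq0 oppr_eq0 pnatr_eq0/= subr_eq0 => /eqP h /=.
split.
  transitivity ((a1 * b1 * b1 + (a1 * b2) * b2) / (b1 ^+ 2 + b2 ^+ 2)); first by field.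
  by rewrite -h; field.
transitivity (((a2 * b1) * b1 + a2 * b2 * b2) / (b1 ^+ 2 + b2 ^+ 2)); first by field.
by rewrite h; field.
Qed.

Lemma cos1_eq0 x : cos x = 1 -> `|x| < 2 * pi -> x = 0.
Proof.
move=> c1 xpi; pose y := `|x| / 2.
have xe : `|x| = y *+ 2 by rewrite /y mulr2n; lra.
have : cos `|x| = 1 by case: (ger0P x) => _ //; rewrite cosN.
rewrite xe cos_mulr2n => e.
have s0 : sin y ^+ 2 = 0 by have := cos2Dsin2 y; move: e; rewrite mulr2n; lra.
have y0 : 0 <= y by rewrite /y divr_ge0.
move: y0; rewrite le_eqVlt => /orP[/eqP y0|y0].
  by apply/normr0_eq0; rewrite xe -y0 mul0rn.
have : 0 < sin y by apply: sin_gt0_pi; rewrite y0 /y; lra.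
by move/eqP: s0; rewrite sqrf_eq0 => /eqP ->; rewrite ltxx.
Qed.

Variables (A1 A2 rho theta : R -> R) (th0 th1 : R).
Hypothesis cA1 : continuous A1.
Hypothesis cA2 : continuous A2.
Hypothesis A00 : A1 0 = 0 /\ A2 0 = 0.
Hypothesis A10 : A1 1 = 0 /\ A2 1 = 0.
Hypothesis polarA : forall t, 0 < t < 1 ->
  [/\ 0 < rho t, A1 t = rho t * cos (theta t) & A2 t = rho t * sin (theta t)].
Hypothesis ctheta : forall t, 0 < t < 1 -> {for t, continuous theta}.
Hypothesis theta0 : theta t @[t --> 0^'+] --> th0.
Hypothesis theta1 : theta t @[t --> 1^'-] --> th1.
Hypothesis th_opp : cos (th1 - th0) = -1.
Hypothesis A_inj : forall x t, 0 < x <= 1 / 2 -> x < t < 1 ->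
  A1 t = A1 x -> A2 t <> A2 x.

Let n t := A1 t ^+ 2 + A2 t ^+ 2.

Let nE t : 0 < t < 1 -> n t = rho t ^+ 2.
Proof.
move=> /polarA[_ h1 h2]; rewrite /n h1 h2 -[RHS]mulr1 -(cos2Dsin2 (theta t)).
by ring.
Qed.

Let n_gt0 t : 0 < t < 1 -> 0 < n t.
Proof. by move=> t01; have [r0 _ _] := polarA t01; rewrite nE// exprn_gt0. Qed.

Let n_cont : continuous n.
Proof. by rewrite /n; cont. Qed.

Let sin_th : sin (th1 - th0) = 0.
Proof.
have := cos2Dsin2 (th1 - th0); rewrite th_opp sqrrN expr1n => h.
by apply/eqP; rewrite -sqrf_eq0; apply/eqP; lra.
Qed.

(** The point minimizes the distance to the end point among those that are
    neither too close to the start nor to the end of the curve. After it the curve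
    is at least as far from the end point, except in its very last part, which
    arrives from nearly the opposite direction. *)
Lemma start_point : exists x0 : R, [/\ 0 < x0 <= 1 / 2, `|theta x0 - th0| < 4^-1 &
  forall t l, x0 < t < 1 -> 0 <= l <= 1 -> A1 t = l * A1 x0 -> A2 t <> l * A2 x0].
Proof.
(* Two angles known up to [1/4] each have a difference known up to less than
   [pi / 2]. *)
have e4 : (0 : R) < 4^-1 by rewrite invr_gt0.
have /cvgr_distC_lt/(_ _ e4)/at_right_ex[d0 d0p h0] := theta0.
have /cvgr_distC_lt/(_ _ e4)/at_left_ex[d1 d1p h1] := theta1.
pose d := Num.min d0 (Num.min d1 4^-1).
have dp : 0 < d by rewrite /d !lt_min d0p d1p e4.
have [dd0 dd1 dd4] : [/\ d <= d0, d <= d1 & d <= 4^-1].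
  by rewrite /d !ge_min !lexx !orbT; split.
have [|c] := @EVT_min R n d (1 - d) _ (continuous_subspaceT n_cont); first by lra.
rewrite in_itv/= => /andP[c1 c2] hc.
have nc : 0 < n c by apply: n_gt0; apply/andP; split; lra.
have n0 : n 0 < n c by have [e1 e2] := A00; rewrite {1}/n e1 e2 expr0n/= addr0.
have /cvgr_lt/(_ _ n0)/nbhs_dist_ex[e ep he] := n_cont (x := 0).
pose x1 := Num.min (e / 2) (d / 2).
have x1p : 0 < x1 by rewrite /x1 lt_min !divr_gt0.
have x1d : x1 < d by rewrite /x1 gt_min; apply/orP; right; lra.
have x1e : x1 < e by rewrite /x1 gt_min; apply/orP; left; lra.
have nx1 : n x1 < n c by apply: he; rewrite subr0 gtr0_norm.
have [|x0] := @EVT_min R n x1 (1 - d) _ (continuous_subspaceT n_cont); first by lra.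
rewrite in_itv/= => /andP[x01 x02] hx0.
have nx0 : n x0 < n c.
  by apply: le_lt_trans nx1; apply: hx0; rewrite in_itv/= lexx; lra.
have x0d : x0 < d.
  rewrite ltNge; apply/negP => dx0; move: nx0; rewrite ltNge hc// in_itv/= dx0; lra.
have x0p : 0 < x0 by lra.
have x0in : 0 < x0 < 1 by apply/andP; split; lra.
have thx0 : `|theta x0 - th0| < 4^-1 by apply: h0; apply/andP; split; lra.
exists x0; split => //; first by apply/andP; split; lra.
move=> t l /andP[t0 t1] /andP[l0 l1] e1 e2.
have tin : 0 < t < 1 by apply/andP; split; lra.
have ne : n t = l ^+ 2 * n x0 by rewrite /n e1 e2; ring.
have l_gt0 : 0 < l.
  rewrite lt_neqAle l0 andbT; apply/eqP => le; have := n_gt0 tin.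
  by rewrite ne -le expr0n/= mul0r ltxx.
have [td|td] := leP t (1 - d).
  have nle : n x0 <= n t by apply: hx0; rewrite in_itv/=; lra.
  have nx : 0 < n x0 := n_gt0 x0in.
  have l2 : l = 1.
    rewrite ne in nle.
    have l21 : 1 <= l ^+ 2 by rewrite -(ler_pM2r nx) mul1r.
    by apply/eqP; rewrite eq_le l1 leNgt; apply/negP => ll; nra.
  apply: (A_inj (x := x0) (t := t)); last by rewrite e2 l2 mul1r.
  - by apply/andP; split; lra.
  - by apply/andP; split; lra.
  - by rewrite e1 l2 mul1r.
have tht : `|theta t - th1| < 4^-1 by apply: h1; apply/andP; split; lra.
have [rt ct st] := polarA tin; have [rx cx sx] := polarA x0in.
have r_eq : rho t = l * rho x0.
  apply/eqP; rewrite -(@eqrXn2 _ 2%N) ?(ltW rt) ?mulr_ge0 ?(ltW rx)//.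
  by rewrite -nE// exprMn -[rho x0 ^+ 2]nE// ne.
have lr : l * rho x0 != 0 by rewrite -r_eq lt0r_neq0.
have ec : cos (theta t) = cos (theta x0).
  by apply: (mulfI lr); rewrite -r_eq -ct e1 cx r_eq; ring.
have es : sin (theta t) = sin (theta x0).
  by apply: (mulfI lr); rewrite -r_eq -st e2 sx r_eq; ring.
(* The two directions are nearly opposite, yet equal. *)
pose eps := (theta t - th1) - (theta x0 - th0).
have ceps : 0 < cos eps.
  apply: cos_gt0_pihalf; have := pi_ge2 R => pi2.
  move: tht thx0; rewrite !ltr_norml => /andP[? ?] /andP[? ?].
  by rewrite /eps; apply/andP; split; lra.
have : cos (theta t - theta x0) = 1 by rewrite cosB ec es -!expr2 cos2Dsin2.
have -> : theta t - theta x0 = (th1 - th0) + eps by rewrite /eps; lra.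
by rewrite cosD th_opp sin_th mul0r subr0; lra.
Qed.

(** The angle of the curve seen from its end point and the argument of [z] vary
    together, up to less than [pi]. If their variations ever differed by [pi],
    then [1 - p] would be a positive multiple [c z] of [z]. As [|z| > 1], the
    imaginary parts of [p = (z + 1/z) / 2] and [z] have the same sign, so [z]
    would be real; but then [p] has the sign of [z] and absolute value at least
    1, unlike [1 - c z]. *)
Lemma angle_bound x0 X Y (s r : R -> R) : 0 < x0 <= 1 / 2 ->
  (forall t, 0 <= t < 1 -> X t = frameX (A1 (x0 + t * (1 - x0))) (A2 (x0 + t * (1 - x0))) (A1 x0) (A2 x0)) ->
  (forall t, 0 <= t < 1 -> Y t = frameY (A1 (x0 + t * (1 - x0))) (A2 (x0 + t * (1 - x0))) (A1 x0) (A2 x0)) ->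
  joukowski_path X Y s r -> cos (s 0) = -1 -> (forall t, 0 < t < 1 -> 1 < r t) ->
  forall t, 0 <= t < 1 -> `|(theta (x0 + t * (1 - x0)) - theta x0) - (s t - s 0)| < pi.
Proof.
move=> /andP[x0p x0h] hX hY [cs cr h] cs0 r1 T /andP[T0 T1].
have pi0 := pi_gt0 R.
have ss0 : sin (s 0) = 0.
  have := cos2Dsin2 (s 0); rewrite cs0 sqrrN expr1n => e.
  by apply/eqP; rewrite -sqrf_eq0; apply/eqP; lra.
pose del t := (theta (x0 + t * (1 - x0)) - theta x0) - (s t - s 0).
have x0in : 0 < x0 < 1 by apply/andP; split; lra.
have [rx cx sx] := polarA x0in.
have never t : 0 <= t < 1 -> cos (del t) <> -1.
  move=> t01 cd; have /andP[t0 t1] := t01.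
  have sd : sin (del t) = 0.
    have := cos2Dsin2 (del t); rewrite cd sqrrN expr1n => e.
    by apply/eqP; rewrite -sqrf_eq0; apply/eqP; lra.
  pose tau := x0 + t * (1 - x0).
  have tin : 0 < tau < 1 by rewrite /tau; apply/andP; split; nra.
  have [rt ct st] := polarA tin.
  have [r0 ] := h t; rewrite hX// hY// -/tau /frameX /frameY ct st cx sx.
  have -> : (rho x0 * cos (theta x0)) ^+ 2 + (rho x0 * sin (theta x0)) ^+ 2 = rho x0 ^+ 2.
    by rewrite -[RHS]mulr1 -(cos2Dsin2 (theta x0)); ring.
  have phi : theta tau = theta x0 + (del t + s t - s 0) by rewrite /del -/tau; lra.
  have cphi : cos (theta tau - theta x0) = cos (s t).
    have -> : theta tau - theta x0 = del t + (s t - s 0) by rewrite phi; lra.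
    by rewrite cosD cd sd cosB cs0 ss0; ring.
  have sphi : sin (theta tau - theta x0) = sin (s t).
    have -> : theta tau - theta x0 = del t + (s t - s 0) by rewrite phi; lra.
    by rewrite sinD cd sd sinB cs0 ss0; ring.
  have rxn := lt0r_neq0 rx; have rn := lt0r_neq0 r0.
  move=> eX eY; pose k := rho tau / rho x0.
  have k0 : 0 < k by rewrite /k divr_gt0.
  have {}eX : 1 - 2 * k * cos (s t) = (r t + (r t)^-1) / 2 * cos (s t).
    by rewrite -eX -cphi cosB /k; field.
  have {}eY : - 2 * k * sin (s t) = (r t - (r t)^-1) / 2 * sin (s t).
    by rewrite -eY -sphi sinB /k; field.
  have r_ge1 : 1 <= r t \/ cos (s t) = -1.
    move: t0; rewrite le_eqVlt => /orP[/eqP <-|t0]; [by right|left].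
    by apply/ltW/r1; rewrite t0.
  have cs2 := cos2Dsin2 (s t).
  have ri : r t * (r t)^-1 = 1 by rewrite mulfV.
  have ri0 : 0 < (r t)^-1 by rewrite invr_gt0.
  have cle : cos (s t) <= 1 by exact: cos_le1.
  have ssn : sin (s t) = 0.
    apply/eqP; apply: contraT => sn.
    have e : - 2 * k = (r t - (r t)^-1) / 2 by apply: (mulIf sn).
    case: r_ge1 => [r_ge1|c1]; first by nra.
    have /eqP : sin (s t) ^+ 2 = 0 by move: cs2; rewrite c1 sqrrN expr1n; lra.
    by rewrite sqrf_eq0 (negbTE sn).
  have /orP[/eqP c1|/eqP c1] : (cos (s t) == 1) || (cos (s t) == -1).
  - by rewrite -sqrf_eq1 -cs2 ssn expr0n/= addr0.
  - by rewrite c1 in eX r_ge1; nra.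
  - by rewrite c1 in eX; nra.
have T01 : 0 <= T < 1 by rewrite T0.
pose g t := del (clamp 0 T t).
have cg : continuous g.
  move=> t; rewrite /g /del; set u := clamp 0 T t.
  have /andP[u0 uT] : 0 <= u <= T by exact: clamp_in.
  have tin : 0 < x0 + u * (1 - x0) < 1 by apply/andP; split; nra.
  have cc := @clamp_cont R 0 T.
  have c1 : continuous (fun t => x0 + clamp 0 T t * (1 - x0)) by cont.
  have c2 : continuous (fun t => s (clamp 0 T t)) by exact: cont_comp.
  apply: cvgB; last by apply: cvgB; [exact: c2|exact: cvg_cst].
  by apply: cvgB; [exact: (continuous_comp (c1 t) (ctheta tin))|exact: cvg_cst].
have g0 : g 0 = 0 by rewrite /g clamp_id ?lexx// /del mul0r addr0 !subrr.
have gT : g T = del T by rewrite /g clamp_id// T0 lexx.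
have cl t : 0 <= clamp 0 T t < 1.
  by have /andP[-> h2] := clamp_in t T0; rewrite (le_lt_trans h2).
rewrite ltNge; apply/negP => big.
have [pos|neg] := leP 0 (del T).
  have {}big : pi <= del T by rewrite ger0_norm in big.
  have [|t _ ht] := @IVT R g 0 T pi T0 (continuous_subspaceT cg).
    by rewrite ge_min le_max g0 gT big (ltW pi0) orbT.
  by apply: (never (clamp 0 T t)) => //; rewrite -/(g t) ht cospi.
have {}big : del T <= - pi by rewrite ltr0_norm// lerNr in big.
have [|t _ ht] := @IVT R g 0 T (- pi) T0 (continuous_subspaceT cg).
  by rewrite ge_min le_max g0 gT big orbT/= oppr_le0 ltW.
by apply: (never (clamp 0 T t)) => //; rewrite -/(g t) ht cosN cospi.
Qed.

Let from x0 (f : R -> R) t := f (x0 + t * (1 - x0)).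

(** The variation of the argument of [z] and [th1 - th0] are both congruent to
    [pi] modulo [2 * pi], and they differ by less than [2 * pi]. The modulus of
    [z] stays on the same side of 1 because [p] avoids the segment between the
    branch points; inverting [z] if necessary, it is larger than 1. *)
Lemma turning_from_start_point x0 X Y J : 0 < x0 <= 1 / 2 ->
  `|theta x0 - th0| < 4^-1 ->
  (forall t l, x0 < t < 1 -> 0 <= l <= 1 -> A1 t = l * A1 x0 -> A2 t <> l * A2 x0) ->
  normalized_arc X Y ->
  (forall t, 0 <= t < 1 -> X t = frameX (from x0 A1 t) (from x0 A2 t) (A1 x0) (A2 x0)) ->
  (forall t, 0 <= t < 1 -> Y t = frameY (from x0 A1 t) (from x0 A2 t) (A1 x0) (A2 x0)) ->
  turning X Y J -> J = `|th1 - th0|.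
Proof.
move=> x0h thx0 seg nXY hX hY [s [r [lift ->]]].
have /andP[x0p x02] := x0h; have pi0 := pi_gt0 R; have pi2 := pi_ge2 R.
have [cX cY X0 X1 Xin] := nXY.
have x0in : 0 < x0 < 1 by apply/andP; split; lra.
have key (s' r' : R -> R) : joukowski_path X Y s' r' -> (forall t, 0 < t < 1 -> 1 < r' t) ->
    s' 1 - s' 0 = th1 - th0.
  move=> lift' r1; have [cs cr h] := lift'.
  have [ss0 cs0] : sin (s' 0) = 0 /\ cos (s' 0) = -1.
    have [e1 e2] := X0 0 (lexx _).
    by have := h 0; rewrite e1 e2 => /joukowski_branch; apply; ring.
  have [ss1 cs1] : sin (s' 1) = 0 /\ cos (s' 1) = 1.
    have [e1 e2] := X1 1 (lexx _).
    by have := h 1; rewrite e1 e2 => /joukowski_branch; apply; ring.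
  have bound := angle_bound x0h hX hY lift' cs0 r1.
  have e4 : (0 : R) < 4^-1 by rewrite invr_gt0.
  have /cvgr_distC_lt/(_ _ e4)/at_left_ex[d1 d1p h1] := theta1.
  have lim1 : s' t @[t --> (1 : R)] --> s' 1 by exact: cs.
  have /cvgr_distC_lt/(_ _ e4)/nbhs_dist_ex[d2 d2p h2] := lim1.
  pose d := Num.min d1 (Num.min d2 1).
  have dp : 0 < d by rewrite /d !lt_min d1p d2p ltr01.
  have [dd1 dd2 dd4] : [/\ d <= d1, d <= d2 & d <= 1].
    by rewrite /d !ge_min !lexx !orbT; split.
  pose t := 1 - d / 2.
  have t01 : 0 <= t < 1 by rewrite /t; apply/andP; split; lra.
  have /andP[t0 t1] := t01.
  have b1 := bound t t01.
  have b2 : `|theta (x0 + t * (1 - x0)) - th1| < 4^-1.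
    by apply: h1; apply/andP; split; rewrite /t; nra.
  have b3 : `|s' t - s' 1| < 4^-1.
    by apply: h2; rewrite /t ltr_norml; apply/andP; split; lra.
  apply/esym/subr0_eq/cos1_eq0.
    by rewrite cosB th_opp sin_th cosB cs1 cs0 ss0 ss1; ring.
  move: b1 b2 b3 thx0; rewrite !ltr_norml => /andP[? ?] /andP[? ?] /andP[? ?] /andP[? ?].
  by apply/andP; split; lra.
have [cs cr h] := lift.
have rn1 t : 0 < t < 1 -> r t != 1.
  move=> t01; apply/eqP => r1; have /andP[t0 t1] := t01.
  have [_ ex ey] := h t; rewrite r1 invr1 subrr !mul0r in ey.
  have {}ex : X t = cos (s t) by rewrite ex r1 invr1; field.
  have t01' : 0 <= t < 1 by rewrite (ltW t0) t1.
  have [e1 e2] := frameY_eq0 (n_gt0 x0in) (etrans (esym (hY t t01')) ey).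
  rewrite -hX// in e1 e2.
  apply: seg e1 e2; first by apply/andP; split; nra.
  have := cos_le1 (s t); have := cos_geN1 (s t); rewrite ex => ? ?.
  by apply/andP; split; lra.
have c1 : continuous (fun t => r t - 1) by cont.
pose half : R := 1 / 2.
have half01 : 0 < half < 1 by rewrite /half; apply/andP; split; lra.
have same t : 0 < t < 1 -> (0 < (r t - 1) * (r half - 1)).
  move=> t01; rewrite ltNge; apply/negP => neg.
  have : exists2 c, 0 < c < 1 & r c = 1.
    have lo : Num.min (r half) (r t) <= 1 <= Num.max (r half) (r t).
      have n1 := rn1 half half01; have n2 := rn1 t t01.
      rewrite ge_min le_max; case: (ltgtP (r half) 1) n1 => // a1 _;
        case: (ltgtP (r t) 1) n2 => // a2 _; exfalso; nra.
    have [ht|th] := leP half t.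
      have [c + rc] := @IVT R r half t 1 ht (continuous_subspaceT cr) lo.
      rewrite in_itv/= => /andP[h1 h2]; exists c => //.
      by case/andP: half01 => ? ?; case/andP: t01 => ? ?; apply/andP; split; lra.
    have [|c + rc] := @IVT R r t half 1 (ltW th) (continuous_subspaceT cr).
      by rewrite minC maxC.
    rewrite in_itv/= => /andP[h1 h2]; exists c => //.
    by case/andP: half01 => ? ?; case/andP: t01 => ? ?; apply/andP; split; lra.
  by case=> c c01 rc; have := rn1 c c01; rewrite rc eqxx.
have [big|small] := ltP 1 (r half).
  rewrite (key s r)// => t t01; have := same t t01.
  by rewrite pmulr_lgt0 subr_gt0.
have r_lt1 t : 0 < t < 1 -> r t < 1.
  move=> t01; have := same t t01; rewrite nmulr_lgt0 ?subr_lt0//.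
  by rewrite lt_neqAle rn1.
have r_gt0 t : 0 < r t by have [] := h t.
rewrite -(key (fun t => - s t) (fun t => (r t)^-1)).
- by rewrite -[RHS]normrN; congr (`|_|); lra.
- split; first by cont.
    by apply: contV => // t; rewrite lt0r_neq0.
  by move=> t; exact: joukowskiV.
- by move=> t t01; rewrite invf_gt1// r_lt1.
Qed.

(** The end of the curve that lies on the connecting arc is contracted: during
    this homotopy the branch points move along with the initial point, until
    they are so close to each other, and away from the rest of the curve, that
    turning about the two of them amounts to turning about one. *)
Lemma turning_winding X Y :
  (forall t, X t = frameX (A1 (1 / 2 + clamp 0 1 t / 2)) (A2 (1 / 2 + clamp 0 1 t / 2))
                         (A1 (1 / 2)) (A2 (1 / 2))) ->
  (forall t, Y t = frameY (A1 (1 / 2 + clamp 0 1 t / 2)) (A2 (1 / 2 + clamp 0 1 t / 2))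
                         (A1 (1 / 2)) (A2 (1 / 2))) ->
  turning X Y `|th1 - th0|.
Proof.
move=> hX hY; have [x0 [/andP[x0p x02] thx0 seg]] := start_point.
pose xu u := x0 + clamp 0 1 u * (1 / 2 - x0).
have xu_in u : 0 < xu u <= 1 / 2.
  by have /andP[u0 u1] := clamp_in u (@ler01 R); rewrite /xu; apply/andP; split; nra.
have xu01 u : 0 < xu u < 1 by have /andP[] := xu_in u => ? ?; apply/andP; split; lra.
pose tau (z : R * R) := xu z.2 + clamp 0 1 z.1 * (1 - xu z.2).
pose HX z := frameX (A1 (tau z)) (A2 (tau z)) (A1 (xu z.2)) (A2 (xu z.2)).
pose HY z := frameY (A1 (tau z)) (A2 (tau z)) (A1 (xu z.2)) (A2 (xu z.2)).
have cc : continuous (fun t : R => clamp 0 1 t) by exact: clamp_cont.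
have cxu : continuous (fun z : R * R => xu z.2).
  have c1 : continuous (fun z : R * R => clamp 0 1 z.2) by apply: (cont_comp cc); cont.
  by rewrite /xu; cont.
have ctau : continuous tau.
  have c1 : continuous (fun z : R * R => clamp 0 1 z.1) by apply: (cont_comp cc); cont.
  by rewrite /tau; cont.
have cd : continuous (fun z : R * R => (A1 (xu z.2) ^+ 2 + A2 (xu z.2) ^+ 2)^-1).
  have c1 : continuous (fun z : R * R => A1 (xu z.2)) by exact: cont_comp.
  have c2 : continuous (fun z : R * R => A2 (xu z.2)) by exact: cont_comp.
  by apply: contV; [move=> z; rewrite lt0r_neq0// n_gt0|cont].
have cHX : continuous HX /\ continuous HY.
  have c1 : continuous (fun z : R * R => A1 (xu z.2)) by exact: cont_comp.
  have c2 : continuous (fun z : R * R => A2 (xu z.2)) by exact: cont_comp.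
  have c3 : continuous (fun z : R * R => A1 (tau z)) by exact: cont_comp.
  have c4 : continuous (fun z : R * R => A2 (tau z)) by exact: cont_comp.
  by split; rewrite /HX /HY /frameX /frameY; cont.
have [{}cHX cHY] := cHX.
have narc u : normalized_arc (fun t => HX (t, u)) (fun t => HY (t, u)).
  have cu (f : R * R -> R) : continuous f -> continuous (fun t => f (t, u)).
    by move=> cf; apply: (cont_comp cf); cont.
  split; [exact: cu|exact: cu|move=> t t0|move=> t t1|].
  - rewrite /HX /HY /tau/= clamp_lt// mul0r addr0; apply: frameXY_self.
    exact: n_gt0.
  - rewrite /HX /HY /tau/= clamp_gt// mul1r [xu u + _]addrC subrK.
    by have [-> ->] := A10; exact: frameXY_0.
  - move=> t /andP[t0 t1]; apply: contraPneq => Y0 /eqP.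
    have t01 : 0 <= t <= 1 by rewrite !ltW.
    have tin : xu u < tau (t, u) < 1.
      rewrite /tau/= clamp_id//; have /andP[? ?] := xu01 u; apply/andP; split; nra.
    have tin' : 0 < tau (t, u) < 1.
      by have /andP[? ?] := xu01 u; have /andP[? ?] := tin; apply/andP; split; lra.
    have [e1 e2] := frameY_eq0 (n_gt0 (xu01 u)) Y0.
    rewrite -/(HX (t, u)) in e1 e2.
    rewrite sqrf_eq1 => /orP[]/eqP hx.
      rewrite hx subrr !mul0r in e1 e2.
      by have := n_gt0 tin'; rewrite /n e1 e2 expr0n/= addr0 ltxx.
    rewrite hx (_ : (1 - -1) / 2 = 1) ?mul1r in e1 e2; last by field.
    exact: (A_inj (xu_in u) tin e1).
have [J [T0 T1]] := turning_homotopy cHX cHY narc.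
have xe : x0 + 1 * (1 / 2 - x0) = 1 / 2 by lra.
have ce c : c * (1 - 1 / 2) = c / 2 by lra.
have -> : X = fun t => HX (t, 1).
  apply/funext => t; rewrite hX /HX /tau /xu/= (clamp_id (x := 1)) ?ler01 ?lexx//.
  by rewrite xe ce.
have -> : Y = fun t => HY (t, 1).
  apply/funext => t; rewrite hY /HY /tau /xu/= (clamp_id (x := 1)) ?ler01 ?lexx//.
  by rewrite xe ce.
suff <- : J = `|th1 - th0| by [].
have xu0 : xu 0 = x0 by rewrite /xu clamp_id ?ler01 ?lexx// mul0r addr0.
apply: (turning_from_start_point (x0 := x0) _ thx0 seg (narc 0) _ _ T0).
- by rewrite x0p.
- by move=> t /andP[t0 t1]; rewrite /HX /tau/= xu0 clamp_id// t0 ltW.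
- by move=> t /andP[t0 t1]; rewrite /HY /tau/= xu0 clamp_id// t0 ltW.
Qed.

End Winding.

(** * Rail isotopies *)

Lemma within_comp (S T U : topologicalType) (A : set T) (f : T -> U) (g : S -> T) :
  {within A, continuous f} -> continuous g -> (forall x, A (g x)) ->
  continuous (fun x => f (g x)).
Proof.
move=> /subspace_continuousP cf cg gA x.
apply: cvg_comp; last exact: (cf _ (gA x)).
move=> B nB.
suff : nbhs x (g @^-1` B) by [].
have : nbhs x (g @^-1` [set y | A y -> B y]) by exact: cg x _ nB.
by apply: filterS => z; apply; exact: gA.
Qed.

Section Reparametrization.
Context {R : realType} {V : normedModType R}.

Lemma clamp01_in (t : R) : `[0, 1]%classic (clamp 0 1 t).
Proof. by rewrite /= in_itv/=; apply: clamp_in; exact: ler01. Qed.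

(** The inverse of an injective arc is continuous because its domain is
    compact. *)
Lemma arc_reparam (f k : R -> V) : {within `[0, 1], continuous f} ->
  {in `[0, 1]%R &, injective f} -> {within `[0, 1], continuous k} ->
  k @` `[0, 1] `<=` f @` `[0, 1] ->
  exists phi : R -> R, [/\ continuous phi, forall t, 0 <= phi t <= 1 &
    forall t, f (phi t) = k (clamp 0 1 t)].
Proof.
move=> cf injf ck kf.
have /choice[phi hphi] : forall t : R, exists x : R,
    `[0, 1]%classic x /\ f x = k (clamp 0 1 t).
  move=> t; have [|x x01 fx] := kf (k (clamp 0 1 t)); last by exists x.
  by exists (clamp 0 1 t) => //; exact: clamp01_in.
exists phi; split; last by move=> t; have [_] := hphi t.
  apply/continuous_closedP => A cA.
  have -> : phi @^-1` A = (fun t => k (clamp 0 1 t)) @^-1` (f @` (A `&` `[0, 1])).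
    apply/seteqP; split => t /=; have [p01 e] := hphi t.
      by move=> At; exists (phi t).
    move=> [x [Ax x01]]; rewrite -e => fx.
    by have <- : x = phi t by apply: injf; rewrite ?inE.
  have : closed (f @` (A `&` `[0, 1])).
    apply: compact_closed; first exact: norm_hausdorff.
    apply: continuous_compact.
      by apply: continuous_subspaceW cf => x [].
    by rewrite setIC; apply: compact_closedI => //; exact: segment_compact.
  have ckc := within_comp ck (@clamp_cont R 0 1) clamp01_in.
  by move/continuous_closedP: ckc; exact.
by move=> t; have [] := hphi t; rewrite /= in_itv.
Qed.

End Reparametrization.

Section Rails.
Context {R : realType}.
Variables (l1 l2 : set 'rV[R]_3) (d : 'rV[R]_3) (P : 'M[R]_(3, 2)).
Hypothesis hrails : parallel_rails d l1 l2.
Hypothesis hP : perp_projection d P.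

Lemma kernel_projection (v : 'rV[R]_3) : v *m P = 0 -> exists c, v = c *: d.
Proof.
have [d0 _ _ _] := hrails; have [PP dP] := hP => vP.
have rP : \rank P = 2%N.
  apply/eqP; rewrite eqn_leq rank_leq_col/=.
  by have := mxrankM_maxr P^T P; rewrite PP mxrank1.
have rk : \rank (kermx P) = 1%N by rewrite mxrank_ker rP.
have dk : (d <= kermx P)%MS by apply/sub_kermxP.
have kd : (kermx P <= d)%MS.
  by have := mxrank_leqif_sup dk; rewrite rk rank_rV d0 => -[_]; rewrite eqxx => /esym.
have vk : (v <= kermx P)%MS by apply/sub_kermxP.
by have /sub_rVP[c ->] := submx_trans vk kd; exists c.
Qed.

Lemma on_lineP (a v : 'rV[R]_3) : line a d v <-> v *m P = a *m P.
Proof.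
have [_ dP] := hP; split.
  by move=> [t _ <-]; rewrite mulmxDl -scalemxAl dP scaler0 addr0.
move=> e; have [|c vc] := @kernel_projection (v - a); first by rewrite mulmxBl e subrr.
by exists c => //; rewrite -vc addrC subrK.
Qed.

Lemma rails_projection : exists T H : 'rV[R]_2, [/\ T <> H,
  forall v, l1 v <-> v *m P = T & forall v, l2 v <-> v *m P = H].
Proof.
have [_ [a1 e1] [a2 e2] ne] := hrails.
exists (a1 *m P), (a2 *m P); split.
- move=> e; apply: ne; rewrite e1 e2; apply/seteqP; split => v /on_lineP h.
    by apply/on_lineP; rewrite h.
  by apply/on_lineP; rewrite h.
- by move=> v; rewrite e1; exact: on_lineP.
- by move=> v; rewrite e2; exact: on_lineP.
Qed.

End Rails.

Section PlaneCoordinates.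
Context {R : realType}.
Implicit Types (G T H : 'rV[R]_2) (r : R -> 'rV[R]_3).

Definition planeX T H G : R :=
  frameX ((G - H) 0 0) ((G - H) 0 1) ((T - H) 0 0) ((T - H) 0 1).
Definition planeY T H G : R :=
  frameY ((G - H) 0 0) ((G - H) 0 1) ((T - H) 0 0) ((T - H) 0 1).

Lemma rV2P (u v : 'rV[R]_2) : u 0 0 = v 0 0 -> u 0 1 = v 0 1 -> u = v.
Proof.
move=> h0 h1; apply/rowP => i; case: i => [[|[|//]]] hi.
  by rewrite (_ : Ordinal hi = 0)//; exact: val_inj.
by rewrite (_ : Ordinal hi = 1)//; exact: val_inj.
Qed.

Lemma sqnorm_gt0 (u : 'rV[R]_2) : u != 0 -> 0 < u 0 0 ^+ 2 + u 0 1 ^+ 2.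
Proof.
move=> u0; rewrite lt_neqAle addr_ge0 ?sqr_ge0// andbT eq_sym.
apply: contra u0; rewrite paddr_eq0 ?sqr_ge0// !sqrf_eq0 => /andP[/eqP h0 /eqP h1].
by apply/eqP/rV2P; rewrite mxE.
Qed.

Lemma planeXY_tail T H : T <> H -> planeX T H T = -1 /\ planeY T H T = 0.
Proof.
move=> TH; apply: frameXY_self; apply: sqnorm_gt0.
by rewrite subr_eq0; apply/eqP.
Qed.

Lemma planeXY_head T H : planeX T H H = 1 /\ planeY T H H = 0.
Proof. by rewrite /planeX /planeY subrr !mxE; exact: frameXY_0. Qed.

Lemma planeXY_other T H G : T <> H -> G <> T -> G <> H ->
  planeX T H G ^+ 2 = 1 -> planeY T H G != 0.
Proof.
move=> TH GT GH X2; apply/eqP => Y0.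
have b0 : 0 < (T - H) 0 0 ^+ 2 + (T - H) 0 1 ^+ 2.
  by apply: sqnorm_gt0; rewrite subr_eq0; apply/eqP.
have [e1 e2] := frameY_eq0 b0 Y0; rewrite -/(planeX T H G) in e1 e2.
have key l : (G - H) 0 0 = l * (T - H) 0 0 -> (G - H) 0 1 = l * (T - H) 0 1 ->
    G = l *: (T - H) + H.
  by move=> h0 h1; apply/(canRL (subrK H))/rV2P; rewrite ?h0 ?h1 !mxE.
have /eqP := X2; rewrite sqrf_eq1 => /orP[]/eqP Xe; rewrite Xe in e1 e2.
  by apply: GH; rewrite (key _ e1 e2) subrr mul0r scale0r add0r.
by apply: GT; rewrite (key _ e1 e2) (_ : (1 - -1) / 2 = 1) ?scale1r ?subrK//; field.
Qed.

Lemma coord_cont (S : topologicalType) n (f : S -> 'rV[R]_n) (j : 'I_n) :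
  continuous f -> continuous (fun x => f x 0 j).
Proof. by move=> cf; exact: (cont_comp (@coord_continuous R 1 n 0 j) cf). Qed.

Lemma planeXY_cont (S : topologicalType) T H (f : S -> 'rV[R]_2) :
  continuous (fun x => f x 0 0) -> continuous (fun x => f x 0 1) ->
  continuous (fun x => planeX T H (f x)) /\ continuous (fun x => planeY T H (f x)).
Proof.
move=> c0 c1.
have d0 : continuous (fun x => (f x - H) 0 0).
  by rewrite (_ : (fun x => _) = fun x => f x 0 0 - H 0 0); [cont|apply/funext => x; rewrite !mxE].
have d1 : continuous (fun x => (f x - H) 0 1).
  by rewrite (_ : (fun x => _) = fun x => f x 0 1 - H 0 1); [cont|apply/funext => x; rewrite !mxE].
by rewrite /planeX /planeY /frameX /frameY; split; cont.
Qed.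

Lemma mulmx_coord_cont (S : topologicalType) (P : 'M[R]_(3, 2)) (f : S -> 'rV[R]_3) j :
  continuous f -> continuous (fun x => (f x *m P) 0 j).
Proof.
move=> cf; have c i := @coord_cont S 3 f i cf.
have -> : (fun x => (f x *m P) 0 j) = fun x => f x 0 0 * P 0 j + (f x 0 1 * P 1 j + f x 0 (1 + 1) * P (1 + 1) j).
  apply/funext => x; rewrite mxE !big_ord_recl big_ord0 addr0.
  by congr (_ + (_ * P _ _ + _ * P _ _)); try congr (f x _ _); exact: val_inj.
by have := c 0; have := c 1; have := c (1 + 1) => h1 h2 h3; cont.
Qed.

End PlaneCoordinates.

Section RailArcTurning.
Context {R : realType}.
Variables (l1 l2 : set 'rV[R]_3) (P : 'M[R]_(3, 2)) (T H : 'rV[R]_2).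
Hypothesis TH : T <> H.
Hypothesis l1P : forall v, l1 v <-> v *m P = T.
Hypothesis l2P : forall v, l2 v <-> v *m P = H.
Implicit Types (r : R -> 'rV[R]_3).

Definition arcX r t : R := planeX T H (r (clamp 0 1 t) *m P).
Definition arcY r t : R := planeY T H (r (clamp 0 1 t) *m P).

Lemma normalized_projection r : continuous r ->
  (forall t, t <= 0 -> l1 (r t)) -> (forall t, 1 <= t -> l2 (r t)) ->
  (forall t, 0 < t < 1 -> ~ (l1 `|` l2) (r t)) ->
  normalized_arc (fun t => planeX T H (r t *m P)) (fun t => planeY T H (r t *m P)).
Proof.
move=> cr h0 h1 hin.
have [cX cY] := planeXY_cont T H (@mulmx_coord_cont R _ P _ 0 cr) (@mulmx_coord_cont R _ P _ 1 cr).
split => //.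
- by move=> t /h0/l1P->; exact: planeXY_tail.
- by move=> t /h1/l2P->; exact: planeXY_head.
- move=> t /hin h; apply: planeXY_other => //.
    by move/l1P => ?; apply: h; left.
  by move/l2P => ?; apply: h; right.
Qed.

Lemma rail_arc_clamp r : rail_arc l1 l2 r ->
  [/\ continuous (fun t => r (clamp 0 1 t)),
      forall t, t <= 0 -> l1 (r (clamp 0 1 t)),
      forall t, 1 <= t -> l2 (r (clamp 0 1 t)) &
      forall t, 0 < t < 1 -> ~ (l1 `|` l2) (r (clamp 0 1 t))].
Proof.
move=> [[cr _] r0 r1 rin]; split.
- exact: (within_comp cr (@clamp_cont R 0 1) clamp01_in).
- by move=> t t0; rewrite clamp_lt ?ler01.
- by move=> t t0; rewrite clamp_gt ?ler01.
- by move=> t /andP[t0 t1]; rewrite clamp_id ?ltW//; apply: rin; rewrite t0.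
Qed.

Lemma rail_arc_normalized r : rail_arc l1 l2 r ->
  normalized_arc (arcX r) (arcY r).
Proof. by move=> /rail_arc_clamp[? ? ? ?]; exact: normalized_projection. Qed.

Lemma rails_disjoint v : l1 v -> ~ l2 v.
Proof. by move=> /l1P h1 /l2P h2; apply: TH; rewrite -h1. Qed.

(** A rail isotopy projects to a homotopy through arcs joining [T] to [H], and
    its last arc has the same image, hence is the same up to
    reparametrization. *)
Lemma turning_represents r r' : rail_arc l1 l2 r -> represents l1 l2 r r' ->
  exists J, turning (arcX r) (arcY r) J /\ turning (arcX r') (arcY r') J.
Proof.
move=> hr [hr' [F [[cF F0 homF] hF imF]]].
have [cr h0 h1 hin] := rail_arc_clamp hr.
pose K (z : R * R) := F (clamp 0 1 z.2) (r (clamp 0 1 z.1)).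
have c01 (u : R) : 0 <= clamp 0 1 u <= 1 by apply: clamp_in; exact: ler01.
have cK : continuous K.
  have cpair : continuous (fun z : R * R => (clamp 0 1 z.2, r (clamp 0 1 z.1))).
    apply: cont_pair; first by apply: (cont_comp (@clamp_cont R 0 1)); cont.
    by apply: (cont_comp cr); cont.
  apply: (within_comp cF cpair) => z.
  by split => //=; rewrite in_itv/=.
have injF (u : R) : 0 <= u <= 1 -> injective (F u).
  by move=> /homF[_ [g [_ fg _]]]; exact: can_inj fg.
have onto1 (u : R) v : 0 <= u <= 1 -> l1 (F u v) <-> l1 v.
  move=> u01; have [e _] := hF u u01; rewrite -{1}e; split; last by exists v.
  by case=> x lx /(injF u u01) <-.
have onto2 (u : R) v : 0 <= u <= 1 -> l2 (F u v) <-> l2 v.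
  move=> u01; have [_ e] := hF u u01; rewrite -{1}e; split; last by exists v.
  by case=> x lx /(injF u u01) <-.
have cX : continuous (fun z => planeX T H (K z *m P)) /\
          continuous (fun z => planeY T H (K z *m P)).
  exact: planeXY_cont (@mulmx_coord_cont R _ P _ 0 cK) (@mulmx_coord_cont R _ P _ 1 cK).
have [{}cX cY] := cX.
have [|J [T0 T1]] := turning_homotopy cX cY.
  move=> u; apply: (@normalized_projection (fun t => K (t, u))).
  - by apply: (cont_comp cK); cont.
  - by move=> t t0; apply/onto1 => //; exact: h0.
  - by move=> t t1; apply/onto2 => //; exact: h1.
  - by move=> t t01; case=> [/onto1|/onto2] /(_ (c01 u)) h; apply: (hin t t01); [left|right].
have c1 : clamp 0 1 1 = 1 :> R by rewrite clamp_id ?ler01 ?lexx.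
have i01 := c01 1; rewrite c1 in i01.
exists J; split.
  have -> : arcX r = fun t => planeX T H (K (t, 0) *m P).
    by apply/funext => t; rewrite /arcX /K/= (clamp_id (x := 0)) ?lexx ?ler01// F0.
  have -> : arcY r = fun t => planeY T H (K (t, 0) *m P).
    by apply/funext => t; rewrite /arcY /K/= (clamp_id (x := 0)) ?lexx ?ler01// F0.
  exact: T0.
have [[ccr injr] rl1 rl2 rin] := hr; have [[cr' _] r'l1 r'l2 _] := hr'.
pose f t := F 1 (r t).
have cF1 : continuous (F 1) by have [] := homF 1 i01.
have [|||phi [cphi phi01 hphi]] := @arc_reparam R _ f r' _ _ cr'.
- by apply: within_continuous_comp ccr => x _; exact: cF1.
- by move=> x y hx hy /(injF 1 i01); exact: injr.
- rewrite -[X in X `<=` _]/(arc_image r') -imF.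
  by move=> _ [_ [x hx <-] <-]; exists x.
have end0 (x : R) : 0 <= x <= 1 -> l1 (r x) -> x = 0.
  move=> /andP[x0 x1] lx; apply/eqP; apply: contraT => xn.
  have [x1'|x1'] := ltP x 1.
    by exfalso; apply: (rin x); [rewrite lt_neqAle eq_sym xn x0|left].
  have e : x = 1 by apply/eqP; rewrite eq_le x1.
  by exfalso; apply: (rails_disjoint lx); rewrite e.
have end1 (x : R) : 0 <= x <= 1 -> l2 (r x) -> x = 1.
  move=> /andP[x0 x1] lx; apply/eqP; apply: contraT => xn.
  have [x0'|x0'] := ltP 0 x.
    by exfalso; apply: (rin x); [rewrite x0' lt_neqAle xn|right].
  have e : x = 0 by apply/eqP; rewrite eq_le x0'.
  by exfalso; apply: (rails_disjoint (v := r x)) => //; rewrite e.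
have p0 : phi 0 = 0.
  apply: end0 => //; apply/(onto1 1 _ i01); rewrite -/(f (phi 0)) hphi.
  by rewrite clamp_id ?lexx ?ler01.
have p1 : phi 1 = 1.
  apply: end1 => //; apply/(onto2 1 _ i01); rewrite -/(f (phi 1)) hphi.
  by rewrite clamp_id ?lexx ?ler01.
have := turning_reparam cphi p0 p1 T1.
have Ke t : K (phi t, 1) = r' (clamp 0 1 t).
  by rewrite -hphi /f /K/= !clamp_id ?lexx ?ler01.
have -> : (fun t => planeX T H (K (t, 1) *m P)) \o phi = arcX r'.
  by apply/funext => t; rewrite /= Ke.
have -> : (fun t => planeY T H (K (t, 1) *m P)) \o phi = arcY r'.
  by apply/funext => t; rewrite /= Ke.
by [].
Qed.

Lemma turning_represented r r1 r2 J1 J2 : rail_arc l1 l2 r ->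
  represents l1 l2 r r1 -> represents l1 l2 r r2 ->
  turning (arcX r1) (arcY r1) J1 -> turning (arcX r2) (arcY r2) J2 -> J1 = J2.
Proof.
move=> hr rep1 rep2 t1 t2.
have [J [a1 b1]] := turning_represents hr rep1.
have [J' [a2 b2]] := turning_represents hr rep2.
have n := rail_arc_normalized hr.
have n1 := rail_arc_normalized (proj1 rep1).
have n2 := rail_arc_normalized (proj1 rep2).
rewrite (turning_uniq n1 t1 b1) (turning_uniq n2 t2 b2).
exact: turning_uniq n a1 a2.
Qed.

Lemma planeXY_affine u (a b : 'rV[R]_2) :
  planeX T H ((1 - u) *: a + u *: b) = (1 - u) * planeX T H a + u * planeX T H b /\
  planeY T H ((1 - u) *: a + u *: b) = (1 - u) * planeY T H a + u * planeY T H b.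
Proof. by rewrite /planeX /planeY /frameX /frameY !mxE; split; ring. Qed.

Lemma turning_lt_sticks r n J : rail_arc l1 l2 r -> made_of_sticks n r ->
  (1 < n)%N -> turning (arcX r) (arcY r) J -> J < n%:R * pi.
Proof.
move=> hr [b [b0 bn hb]] n1; apply: (@turning_sticks R _ _ _ _ b) => //.
  exact: rail_arc_normalized.
have mono i j : (i <= j)%N -> (j <= n)%N -> b i <= b j.
  elim: j => [|j IH]; first by rewrite leqn0 => /eqP->.
  rewrite leq_eqVlt => /orP[/eqP->//|ij jn].
  by apply: le_trans (IH ij (ltnW jn)) _; have [/ltW] := hb j jn.
move=> i iN; have [bi aff] := hb i iN.
have bi0 : 0 <= b i by rewrite -b0; apply: mono => //; exact: ltnW.
have bi1 : b i.+1 <= 1 by rewrite -bn; apply: mono.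
have cl u : b i <= u <= b i.+1 -> clamp 0 1 u = u.
  by move=> /andP[h1 h2]; apply: clamp_id; rewrite (le_trans bi0 h1) (le_trans h2 bi1).
have conv u : 0 <= u <= 1 -> b i <= (1 - u) * b i + u * b i.+1 <= b i.+1.
  by move=> /andP[u0 u1]; apply/andP; split; nra.
split => //.
  move=> u u01; rewrite /arcX !cl ?conv ?lexx ?(ltW bi)// aff// mulmxDl -!scalemxAl.
  by have [-> _] := planeXY_affine u (r (b i) *m P) (r (b i.+1) *m P).
move=> u u01; rewrite /arcY !cl ?conv ?lexx ?(ltW bi)// aff// mulmxDl -!scalemxAl.
by have [_ ->] := planeXY_affine u (r (b i) *m P) (r (b i.+1) *m P).
Qed.

End RailArcTurning.

(** * The winding number of a projection *)

Section LimitDirection.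
Context {R : realType}.

(** The conclusion says, without a norm, that [v] is a nonnegative multiple of the
    unit vector of angle [a]. *)
Lemma limit_direction (F : set_system R) {FF : ProperFilter F}
    (m th : R -> R) (v1 v2 a : R) :
  (\forall x \near F, 0 <= m x) ->
  m x * cos (th x) @[x --> F] --> v1 -> m x * sin (th x) @[x --> F] --> v2 ->
  th x @[x --> F] --> a ->
  v1 * sin a = v2 * cos a /\ 0 <= v1 * cos a + v2 * sin a.
Proof.
move=> m0 h1 h2 ha; have FF' : Filter F by exact: filter_filter.
have hc : cos (th x) @[x --> F] --> cos a.
  by apply: (cvg_comp _ _ ha); exact: continuous_cos.
have hs : sin (th x) @[x --> F] --> sin a.
  by apply: (cvg_comp _ _ ha); exact: continuous_sin.
split.
  have c1 := @cvgM _ _ F FF' _ _ _ _ h1 hs.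
  have c2 := @cvgM _ _ F FF' _ _ _ _ h2 hc.
  have e : (fun x => m x * cos (th x)) \* (fun x => sin (th x)) =
           (fun x => m x * sin (th x)) \* (fun x => cos (th x)).
    by apply/funext => x /=; ring.
  by rewrite e in c1; rewrite -(cvg_lim _ c1)// -(cvg_lim _ c2)//.
have c := @cvgD _ _ _ F FF' _ _ _ _ (@cvgM _ _ F FF' _ _ _ _ h1 hc) (@cvgM _ _ F FF' _ _ _ _ h2 hs).
rewrite -(cvg_lim _ c)//; apply: limr_ge; first by apply/cvg_ex; eexists; exact: c.
apply: filterS m0 => x mx; apply: (le_trans mx); rewrite le_eqVlt.
apply/orP; left; apply/eqP; rewrite -[LHS]mulr1 -(cos2Dsin2 (th x)).
rewrite -[RHS]/(m x * cos (th x) * cos (th x) + m x * sin (th x) * sin (th x)).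
by ring.
Qed.

(** For the velocity [v] of a curve at a point, [a] and [b] are the limit angles
    under which the curve is seen from this point, right after and right before
    it: the curve leaves in the direction of [v] and comes from that of [- v]. *)
Lemma opposite_directions (v1 v2 a b : R) : 0 < v1 ^+ 2 + v2 ^+ 2 ->
  v1 * sin a = v2 * cos a -> 0 <= v1 * cos a + v2 * sin a ->
  v1 * sin b = v2 * cos b -> v1 * cos b + v2 * sin b <= 0 ->
  cos (b - a) = -1.
Proof.
move=> v0 ha la hb lb.
pose l := v1 * cos a + v2 * sin a; have csa := cos2Dsin2 a.
have e1 : v1 = l * cos a.
  transitivity (v1 * (cos a ^+ 2 + sin a ^+ 2)); first by rewrite csa mulr1.
  transitivity (v1 * cos a ^+ 2 + (v1 * sin a) * sin a); first by ring.
  by rewrite ha /l; ring.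
have e2 : v2 = l * sin a.
  transitivity (v2 * (cos a ^+ 2 + sin a ^+ 2)); first by rewrite csa mulr1.
  transitivity ((v2 * cos a) * cos a + v2 * sin a ^+ 2); first by ring.
  by rewrite -ha /l; ring.
have l0 : 0 < l.
  rewrite lt_neqAle la andbT; apply/eqP => l0; move: v0.
  by rewrite e1 e2 -l0 !mul0r expr0n/= addr0 ltxx.
have s0 : sin (b - a) = 0.
  apply: (mulfI (lt0r_neq0 l0)); rewrite mulr0 sinB.
  transitivity ((l * cos a) * sin b - (l * sin a) * cos b); first by ring.
  by rewrite -e1 -e2 hb subrr.
have c0 : cos (b - a) <= 0.
  rewrite -(pmulr_rle0 _ l0) cosB.
  have -> : l * (cos b * cos a + sin b * sin a) = v1 * cos b + v2 * sin b.
    by rewrite {1}e1 {1}e2; ring.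
  by [].
have := cos2Dsin2 (b - a); rewrite s0 expr0n/= addr0 => /eqP.
by rewrite sqrf_eq1 => /orP[]/eqP e //; move: c0; rewrite e ler10.
Qed.

End LimitDirection.

Section KnotoidTurning.
Context {R : realType}.

Lemma polarE (a b : R) : (polar a b) 0 0 = a * cos b /\ (polar a b) 0 1 = a * sin b.
Proof. by rewrite /polar !mxE. Qed.

Lemma derivative_coord (g : R -> 'rV[R]_2) (t : R) (j : 'I_2) :
  smooth_at g t ->
  h^-1 * (g (h + t) - g t) 0 j @[h --> 0^'] --> (g^`()%classic t) 0 j.
Proof.
move=> /nbhs_singleton/(_ 0%N); rewrite derive1n0 => dg.
have c : h^-1 *: (g (h *: 1 + t) - g t) @[h --> (0 : R)^'] --> 'D_1 g t by exact: dg.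
rewrite derive1E.
have := cvg_comp _ _ c (@coord_continuous R 1 2 0 j ('D_1 g t)).
apply: cvg_trans; apply: near_eq_cvg; near=> h.
by rewrite /= [LHS]mxE /GRing.scale/= mulr1.
Unshelve. all: by end_near.
Qed.

Variables (k a g : R -> 'rV[R]_2) (T H : 'rV[R]_2) (w : R).
Hypothesis k0 : k 0 = T.
Hypothesis k1 : k 1 = H.
Hypothesis ck : forall j, continuous (fun t => k (clamp 0 1 t) 0 j).
Hypothesis arc_a : connecting_arc k a.
Hypothesis curve_g : closed_curve k a g.
Hypothesis hw : curve_winding g (1 / 2) w.

(** The closed curve is followed from [H] along the connecting arc to [T], then
    along the projection back to [H]. *)
Lemma turning_knotoid : cos (2 * pi * w) = -1 /\
  turning (fun t => planeX T H (k (clamp 0 1 t))) (fun t => planeY T H (k (clamp 0 1 t)))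
          (2 * pi * `|w|).
Proof.
have [[ca inja] a0 a1 disj] := arc_a.
have [per gk ga _ reg] := curve_g.
have [rho [theta [th0 [th1 [pol cth lim0 lim1 ew]]]]] := hw.
have pi0 := pi_gt0 R.
have ew2 : 2 * pi * w = th1 - th0.
  by rewrite ew mulrC mulfVK// mulf_neq0// ?pnatr_eq0// lt0r_neq0.
have gH : g (1 / 2) = H by rewrite gk ?lexx ?ler01.
(* One of the two terms is constant on each half of [0, 1], and equal to [T]. *)
pose B (t : R) : 'rV[R]_2 := a (clamp 0 1 (2 * t)) + k (clamp 0 1 (2 * t - 1)) - T - H.
have BE (t : R) : 0 <= t <= 1 -> B t = g (1 / 2 + t) - g (1 / 2).
  move=> /andP[t0 t1]; rewrite gH /B; congr (_ - H).
  have [th|th] := leP t (1 / 2).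
    rewrite (clamp_id (x := 2 * t)); last by apply/andP; split; lra.
    rewrite (clamp_lt (x := 2 * t - 1)) ?ler01//; last by lra.
    rewrite k0 addrK -ga; last by apply/andP; split; lra.
    by congr g; lra.
  rewrite (clamp_gt (x := 2 * t)) ?ler01//; last by lra.
  rewrite (clamp_id (x := 2 * t - 1)); last by apply/andP; split; lra.
  rewrite a1 k0 [T + _]addrC addrK.
  rewrite -gk; last by apply/andP; split; lra.
  by rewrite -per; congr g; lra.
have cB j : continuous (fun t => B t 0 j).
  have c1 : continuous (fun t : R => a (clamp 0 1 (2 * t)) 0 j).
    apply: coord_cont; apply: (within_comp ca) => [|t]; last exact: clamp01_in.
    by apply: (cont_comp (@clamp_cont R 0 1)); cont.
  have c2 : continuous (fun t : R => k (clamp 0 1 (2 * t - 1)) 0 j).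
    have c : continuous (fun t : R => 2 * t - 1) by cont.
    exact: (cont_comp (@ck j) c).
  rewrite (_ : (fun t => _) = fun t => a (clamp 0 1 (2 * t)) 0 j +
    k (clamp 0 1 (2 * t - 1)) 0 j - T 0 j - H 0 j); first by cont.
  by apply/funext => t; rewrite /B !mxE.
pose A1 : R -> R := fun t => B t 0 0; pose A2 : R -> R := fun t => B t 0 1.
have cA1 : continuous A1 by exact: cB.
have cA2 : continuous A2 by exact: cB.
have B0 : B 0 = 0 by rewrite BE ?lexx ?ler01// addr0 subrr.
have B1 : B 1 = 0 by rewrite BE ?lexx ?ler01// per subrr.
have A00 : A1 0 = 0 /\ A2 0 = 0 by rewrite /A1 /A2 B0 !mxE.
have A10 : A1 1 = 0 /\ A2 1 = 0 by rewrite /A1 /A2 B1 !mxE.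
have polB (t : R) : 0 < t < 1 -> B t = polar (rho t) (theta t).
  move=> t01; have [_ <-] := pol t t01; apply: BE.
  by have /andP[/ltW-> /ltW->] := t01.
have polarA (t : R) : 0 < t < 1 ->
    [/\ 0 < rho t, A1 t = rho t * cos (theta t) & A2 t = rho t * sin (theta t)].
  move=> t01; have [r0 _] := pol t t01; rewrite /A1 /A2 polB//.
  by have [-> ->] := polarE (rho t) (theta t).
have ctheta (t : R) : 0 < t < 1 -> {for t, continuous theta}.
  move=> t01; move: cth; rewrite continuous_open_subspace; last exact: interval_open.
  by apply; rewrite inE/= in_itv.
have A_inj (x t : R) : 0 < x <= 1 / 2 -> x < t < 1 -> A1 t = A1 x -> A2 t <> A2 x.
  move=> /andP[x0 x2] /andP[xt t1] e1 e2.
  have : B t = B x by exact: rV2P.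
  rewrite !BE; [|by apply/andP; split; lra..]; move/addIr.
  rewrite (_ : 1 / 2 + x = (1 + 2 * x) / 2); last by lra.
  rewrite ga; last by apply/andP; split; lra.
  have [th|th] := leP t (1 / 2).
    rewrite (_ : 1 / 2 + t = (1 + 2 * t) / 2); last by lra.
    rewrite ga; last by apply/andP; split; lra.
    have in1 : 2 * t \in `[0, 1]%R by rewrite in_itv/=; apply/andP; split; lra.
    have in2 : 2 * x \in `[0, 1]%R by rewrite in_itv/=; apply/andP; split; lra.
    by move/(inja _ _ in1 in2); lra.
  rewrite (_ : 1 / 2 + t = (2 * t - 1) / 2 + 1); last by lra.
  rewrite per gk; last by apply/andP; split; lra.
  have in1 : 0 <= 2 * x <= 1 by apply/andP; split; lra.
  have in2 : 0 < 2 * t - 1 < 1 by apply/andP; split; lra.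
  by have /eqP h := disj _ _ in1 in2 => e; apply: h.
have th_opp : cos (th1 - th0) = -1.
  have [sm v0] := reg; set v := g^`()%classic (1 / 2) in v0.
  have d1 j := @cvg_dnbhs_at_right _ _ _ _ _ (@derivative_coord g (1 / 2) j sm).
  have d2 j := @cvg_dnbhs_at_left _ _ _ _ _ (@derivative_coord g (1 / 2) j sm).
  have d2' j : - (h^-1 * (g (h + 1 / 2) - g (1 / 2)) 0 j) @[h --> (0 : R)^'-] --> - v 0 j.
    by apply: cvgN; exact: d2.
  have near0 : \forall h \near (0 : R)^'+, 0 < h < 1.
    near=> h; apply/andP; split; near: h; [exact: nbhs_right_gt|exact: nbhs_right_lt].
  have [p1 p2] : v 0 0 * sin th0 = v 0 1 * cos th0 /\ 0 <= v 0 0 * cos th0 + v 0 1 * sin th0.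
    apply: (@limit_direction R (0^'+) _ (fun h => h^-1 * rho h) theta) => //.
    - by apply: filterS near0 => h /[dup] /andP[h0 _] /polarA[/ltW r0 _ _]; rewrite mulr_ge0// invr_ge0 ltW.
    - apply: cvg_trans (d1 0); apply: near_eq_cvg; apply: filterS near0 => h h01.
      have /andP[/ltW h0 /ltW h1] := h01.
      by rewrite /= [h + _]addrC -BE ?h0// -/(A1 h) -mulrA; have [_ -> _] := polarA h h01.
    - apply: cvg_trans (d1 1); apply: near_eq_cvg; apply: filterS near0 => h h01.
      have /andP[/ltW h0 /ltW h1] := h01.
      by rewrite /= [h + _]addrC -BE ?h0// -/(A2 h) -mulrA; have [_ _ ->] := polarA h h01.
  have near1 : \forall h \near (0 : R)^'-, 0 < 1 + h < 1.
    near=> h.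
    have h0 : h < 0 by near: h; exact: nbhs_left_lt.
    have h1 : -1 < h by near: h; apply: nbhs_left_gt; rewrite ltrN10.
    by apply/andP; split; lra.
  have B_left (h : R) : 0 < 1 + h < 1 -> g (h + 1 / 2) - g (1 / 2) = B (1 + h).
    move=> /andP[h0 h1]; rewrite BE; last by rewrite !ltW.
    by rewrite -[in LHS]per; congr (g _ - _); lra.
  have lim1' : theta (1 + h) @[h --> 0^'-] --> th1.
    apply: cvg_comp lim1 => B' /at_left_ex[e e0 he].
    suff : \forall h \near (0 : R)^'-, B' (1 + h) by [].
    near=> h; apply: he.
    have h0 : h < 0 by near: h; exact: nbhs_left_lt.
    have h1 : - e < h by near: h; apply: nbhs_left_gt; rewrite oppr_lt0.
    by apply/andP; split; lra.
  have [q1 q2] : - v 0 0 * sin th1 = - v 0 1 * cos th1 /\ 0 <= - v 0 0 * cos th1 + - v 0 1 * sin th1.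
    apply: (@limit_direction R (0^'-) _ (fun h => - h^-1 * rho (1 + h)) (fun h => theta (1 + h))) => //.
    - apply: filterS near1 => h /[dup] /andP[_ h0] /polarA[/ltW r0 _ _].
      by rewrite mulr_ge0// oppr_ge0 invr_le0; lra.
    - apply: cvg_trans (d2' 0); apply: near_eq_cvg; apply: filterS near1 => h h01.
      rewrite /= B_left// -/(A1 (1 + h)).
      by have [_ -> _] := polarA _ h01; ring.
    - apply: cvg_trans (d2' 1); apply: near_eq_cvg; apply: filterS near1 => h h01.
      rewrite /= B_left// -/(A2 (1 + h)).
      by have [_ _ ->] := polarA _ h01; ring.
  apply: (opposite_directions (v1 := v 0 0) (v2 := v 0 1)) => //.
  - exact: sqnorm_gt0.
  - lra.
  - lra.
rewrite ew2; split => //.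
have -> : 2 * pi * `|w| = `|th1 - th0|.
  by rewrite -ew2 normrM gtr0_norm// mulr_gt0.
have Bk t : B (1 / 2 + clamp 0 1 t / 2) = k (clamp 0 1 t) - H.
  have /andP[c0 c1] := clamp_in t (@ler01 R).
  rewrite BE; last by apply/andP; split; lra.
  rewrite gH; congr (_ - H); rewrite -gk; last by rewrite c0.
  by rewrite -[RHS]per; congr g; lra.
have Bh : B (1 / 2) = T - H.
  have := Bk 0; rewrite clamp_id ?lexx ?ler01// mul0r addr0 k0; exact.
apply: (turning_winding cA1 cA2 A00 A10 polarA ctheta lim0 lim1 th_opp A_inj).
  by move=> t; rewrite /A1 /A2 Bk Bh.
by move=> t; rewrite /A1 /A2 Bk Bh.
Unshelve. all: by end_near.
Qed.

End KnotoidTurning.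

(** * The bound *)

Lemma one_stick_trivial (R : realType) (l1 l2 : set 'rV[R]_3) (r r' : R -> 'rV[R]_3) :
  represents l1 l2 r r' -> made_of_sticks 1 r' -> trivial_class l1 l2 r.
Proof.
move=> rep [b [b0 b1 hb]]; exists r'; split => //.
have [_ aff] := hb 0%N isT; rewrite b0 b1 in aff.
pose e := r' 1 - r' 0.
have : kermx e^T != 0.
  by rewrite -mxrank_eq0 mxrank_ker mxrank_tr -lt0n subn_gt0 (leq_ltn_trans (rank_leq_row e)).
case/rowV0Pn => n /sub_kermxP ne n0.
exists n^T, (r' 0 *m n^T); split; first by apply: contra n0 => /eqP e0; rewrite -[n]trmxK e0 trmx0.
move=> _ [t t01 <-]; rewrite /plane /=.
move: t01; rewrite /= in_itv/= => t01.
have := aff t t01; rewrite mulr0 mulr1 add0r => ->.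
have en : e *m n^T = 0 by apply: trmx_inj; rewrite trmx_mul trmxK ne trmx0.
have -> : (1 - t) *: r' 0 + t *: r' 1 = r' 0 + t *: e.
  by rewrite /e scalerBl scale1r scalerBr addrAC addrA addrAC.
by rewrite mulmxDl -scalemxAl en scaler0 addr0.
Qed.

(** Here [2 * x] is an odd integer, which rules out [n = 2 * m + 1]. *)
Lemma odd_half_turns (R : realType) (x : R) (m n : nat) : 0 <= x ->
  cos (2 * pi * x) = -1 -> m%:R <= x -> 2 * x < n%:R -> (2 * m + 2 <= n)%N.
Proof.
move=> x0 cx mx xn; have pi0 := pi_gt0 R.
have : (2 * m)%N%:R < n%:R :> R by rewrite natrM; lra.
rewrite ltr_nat => mn; rewrite addn2 ltn_neqAle mn andbT; apply/eqP => e.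
have {}xn : 2 * x < 2 * m%:R + 1 by move: xn; rewrite -e -[(2 * m).+1%:R]natr1 natrM.
pose y := 2 * pi * x - m%:R * (pi *+ 2) - pi.
have cy : cos y = 1.
  have cper k z : cos (z - k%:R * (pi *+ 2)) = cos z :> R.
    elim: k z => [|k IH] z; first by rewrite mul0r subr0.
    rewrite -[LHS]cosD2pi -[RHS]IH; congr cos.
    by rewrite -[k.+1%:R]natr1; ring.
  by rewrite /y cosB sinpi mulr0 addr0 cospi cper cx; ring.
have yb : - pi <= y < 0.
  by rewrite /y mulr2n; apply/andP; split; nra.
have := @cos1_eq0 R y cy; move: yb => /andP[yb1 yb2].
rewrite ltr0_norm// => y0; have : y = 0 by apply: y0; lra.
lra.
Qed.

Local Close Scope classical_set_scope.

Theorem theorem3p9 (R : realType) (l1 l2 : set 'rV[R]_3) (d : 'rV[R]_3)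
    (P : 'M[R]_(3, 2)) (r : R -> 'rV[R]_3) (w : int)
    (hrails : parallel_rails d l1 l2)
    (hP : perp_projection d P)
    (hr : rail_arc l1 l2 r)
    (hnontrivial : ~ trivial_class l1 l2 r)
    (hadmits : admits_connectable_projection l1 l2 P r)
    (hw : winding_number l1 l2 P r w) :
  ((4 + 2 * (`|w|%:~R - 1))%R%:E <= stick_number l1 l2 r)%E.
Proof.
have [T [H [TH l1P l2P]]] := rails_projection hrails hP.
apply/ereal_infP => _ [n [r2 [rep2 sticks]] <-]; rewrite lee_fin.
have n1 : (1 < n)%N.
  move: sticks; case: n => [|[|//]] sticks.
    by have [b [b0 b1 _]] := sticks; move: b1; rewrite b0 => /eqP; rewrite eq_sym oner_eq0.
  by case: hnontrivial; exact: one_stick_trivial rep2 sticks.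
have [r1 [a [g [wg [[rep1 diag] arc_a curve_g wind ->]]]]] := hw.
have [[ccr1 _] r10 r11 _] := proj1 rep1.
have ck j : continuous (fun t => project P r1 (clamp 0 1 t) 0 j).
  by apply: mulmx_coord_cont; have [] := rail_arc_clamp (proj1 rep1).
have k0 : project P r1 0 = T by apply/l1P.
have k1 : project P r1 1 = H by apply/l2P.
have [cw t1] := turning_knotoid k0 k1 ck arc_a curve_g wind.
have hr2 := proj1 rep2.
have [J [t2 _]] : exists J, turning (arcX P T H r2) (arcY P T H r2) J /\ True.
  by have [J [_ ?]] := turning_represents TH l1P l2P hr rep2; exists J.
have eJ := turning_represented TH l1P l2P hr rep1 rep2 t1 t2.
have := turning_lt_sticks TH l1P l2P hr2 sticks n1 t2.
rewrite -eJ => lt; have pi0 := pi_gt0 R.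
have {}lt : 2 * `|wg| < n%:R by rewrite -(ltr_pM2r pi0); lra.
pose m := `|Num.floor `|wg| |%N.
have mE : (m%:R : R) = (Num.floor `|wg|)%:~R.
  by rewrite /m natr_absz ger0_norm// floor_ge0.
have cw' : cos (2 * pi * `|wg|) = -1.
  by case: (ger0P wg) => // _; rewrite mulrN cosN.
have mn : (2 * m + 2 <= n)%N.
  by apply: odd_half_turns cw' _ lt => //; rewrite mE floor_le.
have wm : `|sgz wg * Num.floor `|wg| |%:~R <= m%:R :> R.
  rewrite mE ler_int normrM normr_sgz ger0_norm ?floor_ge0//.
  by case: (wg != 0); rewrite ?mul1r ?mul0r ?floor_ge0.
have : (2 * m%:R + 2 : R) <= n%:R by rewrite -natrM -natrD ler_nat.
by rewrite /=; lra.
Qed.
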